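(* Let $H$ satisfy the standing assumptions (H), let $m\in\mathscr C^{1,2}_{\mathrm{per}}((0,T)\times\mathbb T^d)$ and for $\varepsilon>0$ let $\lambda_H(m,\varepsilon)$ be the eigenvalue of $\partial_t-\Delta+\varepsilon H(\nabla_x\cdot)+m$. Write $\langle m\rangle:=\frac1{T|\mathbb T^d|}\iint_{(0,T)\times\mathbb T^d}m$. Let $\psi_0\in\mathscr C^{1,2}_{\mathrm{per}}((0,T)\times\mathbb T^d)$ be the unique solution of \[\partial_t\psi_0-\Delta\psi_0=\langle m\rangle-m\ \text{ in }(0,T)\times\mathbb T^d,\quad \psi_0(T,\cdot)=\psi_0(0,\cdot),\quad \iint_{(0,T)\times\mathbb T^d}\psi_0=0.\] Then \[\frac{-\lambda_H(m,\varepsilon)-\langle m\rangle}{\varepsilon}\xrightarrow[\varepsilon\to0]{}\frac1{T|\mathbb T^d|}\iint_{(0,T)\times\mathbb T^d}H(\nabla_x\psi_0).\]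
   Context: $\mathbb T^d$ is the $d$-dimensional torus and $T>0$ is fixed. $\mathscr C^{1,2}_{\mathrm{per}}((0,T)\times\mathbb T^d)$ denotes functions that are $T$-periodic in $t$, $\mathbb T^d$-periodic in $x$, $\mathscr C^1$ in $t$ and $\mathscr C^2$ in $x$. Standing assumptions (H) on $H:\mathbb R^d\to\mathbb R$: $H$ is $\mathscr C^2$; $H(p)>H(0)=0$ for $p\neq0$; $\nabla^2_{pp}H(p)$ is symmetric positive definite for $p\neq 0$; there is a continuous, coercive, convex, non-negative function $\mathcal H$ on $[0,\infty)$ with $\mathcal H(a)>\mathcal H(0)=0$ for $a>0$ such that $\mathcal H\big(\|f-\frac{1}{|\mathbb T^d|}\int_{\mathbb T^d}f\|_{L^1(\mathbb T^d)}\big)\le\int_{\mathbb T^d}H(\nabla f)$ for every $f\in\mathscr C^2(\mathbb T^d)$; and there is $\beta\in(0,1)$ with $aH(p)\ge H(a^\beta p)$ for all $a\in(0,1)$, $p\in\mathbb R^d$. Eigenvalue: the eigenvalue of $\partial_t-\Delta+\varepsilon H(\nabla_x\cdot)+m$ is the unique real $\lambda$ for which there exists $\varphi\in\mathscr C^{1,2}_{\mathrm{per}}((0,T)\times\mathbb T^d)$ with $\lambda+\partial_t\varphi-\Delta\varphi+\varepsilon H(\nabla_x\varphi)=-m$. *)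

(* Defs.v *)
From HB Require Import structures.
From mathcomp Require Import all_boot all_order all_algebra.
From mathcomp Require Import all_classical all_reals all_analysis.
Set Implicit Arguments. Unset Strict Implicit. Unset Printing Implicit Defensive.
Import Order.TTheory GRing.Theory Num.Theory.
Import numFieldNormedType.Exports.
Local Open Scope classical_set_scope.
Local Open Scope ring_scope.

(* Torus T^d = R^d / Z^d (unit periods, so |T^d| = 1); points of R^d are row
   vectors 'rV[R]_d.  Space-time functions are u : R -> 'rV[R]_d -> R. *)

Definition evec (R : realType) (d : nat) (i : 'I_d) : 'rV[R]_d := delta_mx 0 i.

Definition pdx (R : realType) (d : nat) (i : 'I_d) (g : 'rV[R]_d -> R)
  (x : 'rV[R]_d) : R := 'D_(evec R i) g x.

Definition gradx (R : realType) (d : nat) (g : 'rV[R]_d -> R) (x : 'rV[R]_d)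
  : 'rV[R]_d := \row_i pdx i g x.

Definition lapx (R : realType) (d : nat) (g : 'rV[R]_d -> R) (x : 'rV[R]_d)
  : R := \sum_(i < d) pdx i (pdx i g) x.

Definition hessx (R : realType) (d : nat) (g : 'rV[R]_d -> R) (x : 'rV[R]_d)
  : 'M[R]_d := \matrix_(i, j) pdx i (pdx j g) x.

Definition dt (R : realType) (d : nat) (u : R -> 'rV[R]_d -> R) (t : R)
  (x : 'rV[R]_d) : R := derive1 (fun s => u s x) t.

Definition xperiodic (R : realType) (d : nat) (g : 'rV[R]_d -> R) : Prop :=
  forall (i : 'I_d) x, g (x + evec R i) = g x.

Definition C2 (R : realType) (d : nat) (g : 'rV[R]_d -> R) : Prop :=
  continuous g /\
  forall i : 'I_d,
    (forall x, derivable g x (evec R i)) /\ continuous (pdx i g) /\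
    forall j : 'I_d,
      (forall x, derivable (pdx i g) x (evec R j)) /\
      continuous (pdx j (pdx i g)).

Definition C12per (R : realType) (d : nat) (T : R) (u : R -> 'rV[R]_d -> R)
  : Prop :=
  (forall t x, u (t + T) x = u t x) /\
  (forall t, xperiodic (u t)) /\
  continuous (fun p : R * 'rV[R]_d => u p.1 p.2) /\
  (forall t x, derivable (fun s => u s x) t 1) /\
  continuous (fun p : R * 'rV[R]_d => dt u p.1 p.2) /\
  forall i : 'I_d,
    (forall t x, derivable (u t) x (evec R i)) /\
    continuous (fun p : R * 'rV[R]_d => pdx i (u p.1) p.2) /\
    forall j : 'I_d,
      (forall t x, derivable (pdx i (u t)) x (evec R j)) /\
      continuous (fun p : R * 'rV[R]_d => pdx j (pdx i (u p.1)) p.2).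

(* integral over the unit cube [0,1]^d (a fundamental domain of T^d),
   as an iterated Lebesgue integral *)
Fixpoint torus_int (R : realType) (d : nat) : ('rV[R]_d -> R) -> R :=
  match d return ('rV[R]_d -> R) -> R with
  | 0 => fun f => f 0
  | n.+1 => fun f =>
      Rintegral (@lebesgue_measure R) `[0, 1]
        (fun s : R => torus_int (fun y : 'rV[R]_n =>
                         f (row_mx (const_mx s : 'rV[R]_1) y)))
  end.

Definition st_int (R : realType) (d : nat) (T : R) (u : R -> 'rV[R]_d -> R)
  : R :=
  Rintegral (@lebesgue_measure R) `[0, T] (fun t => torus_int (u t)).

(* <u> = 1/(T |T^d|) \iint u, with |T^d| = 1 *)
Definition st_mean (R : realType) (d : nat) (T : R) (u : R -> 'rV[R]_d -> R)
  : R := st_int T u / T.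

Definition hypH (R : realType) (d : nat) (H : 'rV[R]_d -> R) : Prop :=
  C2 H /\
  H 0 = 0 /\
  (forall p, p != 0 -> H 0 < H p) /\
  (forall p, p != 0 ->
     (hessx H p)^T = hessx H p /\
     forall v : 'rV[R]_d, v != 0 -> 0 < (v *m hessx H p *m v^T) 0 0) /\
  (exists calH : R -> R,
     {within [set a : R | 0 <= a], continuous calH} /\
     (calH a @[a --> +oo] --> +oo) /\
     (forall a b s : R, 0 <= a -> 0 <= b -> 0 <= s <= 1 ->
        calH (s * a + (1 - s) * b) <= s * calH a + (1 - s) * calH b) /\
     (forall a, 0 <= a -> 0 <= calH a) /\
     calH 0 = 0 /\
     (forall a, 0 < a -> calH 0 < calH a) /\
     (forall f : 'rV[R]_d -> R, xperiodic f -> C2 f ->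
        calH (torus_int (fun x => `|f x - torus_int f|))
        <= torus_int (fun x => H (gradx f x)))) /\
  (exists beta : R, 0 < beta < 1 /\
     forall (a : R) (p : 'rV[R]_d), 0 < a < 1 ->
       H ((a `^ beta) *: p) <= a * H p).

Definition is_eigenvalue (R : realType) (d : nat) (T : R)
  (H : 'rV[R]_d -> R) (m : R -> 'rV[R]_d -> R) (eps lam : R) : Prop :=
  exists phi : R -> 'rV[R]_d -> R, C12per T phi /\
    forall t x, lam + dt phi t x - lapx (phi t) x + eps * H (gradx (phi t) x)
                = - m t x.

(* Main.v *)
(* Let [c0] be the space-time mean of [f = H (grad psi0)] and suppose that
   [chi] solves the corrector equation [dt chi - lap chi = c0 - f] up to a
   uniform error [delta].  Then [v = psi0 + eps chi] satisfies
   [dt v - lap v + eps H (grad v) + m = <m> + eps (c0 + O(delta))] for small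
   [eps], and the same operator applied to the eigenfunction [phi] is the
   constant [- lam eps].  Comparing the two at a maximum of [phi - v] and at a
   maximum of [v - phi] gives [|(- lam eps - <m>) / eps - c0| = O(delta)].

   An approximate corrector exists for every [delta]: [f] is a uniform limit of
   trigonometric polynomials, for which the heat equation is solved mode by
   mode. *)

Require Import Defs.
From HB Require Import structures.
From mathcomp Require Import all_boot all_order all_algebra.
From mathcomp Require Import all_classical all_reals all_analysis.
From mathcomp Require Import ring lra.
Import Order.TTheory GRing.Theory Num.Theory.
Import numFieldNormedType.Exports.
Local Open Scope classical_set_scope.
Local Open Scope ring_scope.

Set Implicit Arguments.
Unset Strict Implicit.

(** An exact corrector is out of direct reach: the definitions give [H (grad psi0)] only continuity
    in time, whereas a classical solution of the heat equation asks for more than a continuous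
    right-hand side. The comparison, however, only needs a uniform bound on the residual, so an
    inexact right-hand side costs nothing in the limit. The corrector is compatible with the mean of
    the trigonometric polynomial rather than with [c0], and these two means differ by at most the
    uniform error. The eigenfunction is inspected at one point per comparison, so no estimate
    uniform in [eps] is required of it. What must be uniform is the change of [H (grad psi0)] under
    the perturbation [eps chi]; periodicity supplies this by reducing space-time to a compact
    cell. *)

Section UniformContinuity.
Context {R : realType} {X : Type}.

(** The relation [close] is left abstract because several are used: distance on the line,
    coordinatewise distance in space and in space-time, and nearness of the values of finitely many
    generators. *)
Definition unif_cont_wrt (close : R -> X -> X -> Prop) (f : X -> R) :=
  forall e : R, 0 < e -> exists2 delta : R, 0 < delta &
  forall x y, close delta x y -> `|f x - f y| <= e.

Lemma unif_cont_wrt_lin (close : R -> X -> X -> Prop) (f g : X -> R) (c : R) :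
  (forall d1 d2 x y, d1 <= d2 -> close d1 x y -> close d2 x y) ->
  unif_cont_wrt close f -> unif_cont_wrt close g ->
  unif_cont_wrt close (fun x => f x + c * g x).
Proof.
move=> close_mono uf ug e e0; pose e' := e / (2 * (`|c| + 1)).
have c1 : 0 < `|c| + 1 by rewrite ltr_wpDl.
have e'0 : 0 < e' by rewrite divr_gt0// mulr_gt0.
have [d1 d10 fd] := uf _ (divr_gt0 e0 (ltr0n R 2)).
have [d2 d20 gd] := ug _ e'0.
exists (Num.min d1 d2) => [|x y xy]; first by rewrite lt_min d10.
have Ef : `|f x - f y| <= e / 2.
  by apply/fd/(close_mono _ _ _ _ _ xy); rewrite ge_min lexx.
have Eg : `|g x - g y| <= e'.
  by apply/gd/(close_mono _ _ _ _ _ xy); rewrite ge_min lexx orbT.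
rewrite (_ : _ - _ = (f x - f y) + c * (g x - g y)); last by ring.
rewrite (le_trans (ler_normD _ _))// normrM [e in _ <= e]splitr lerD//.
apply: (@le_trans _ _ (`|c| * e')); first exact: ler_wpM2l.
apply: (@le_trans _ _ ((`|c| + 1) * e')).
  by apply: ler_wpM2r; [exact: ltW|rewrite lerDl].
by rewrite /e' le_eqVlt; apply/orP; left; apply/eqP; field; rewrite gt_eqF.
Qed.

End UniformContinuity.

(** * Bernstein operators and a quantitative Stone-Weierstrass theorem *)

Section BernsteinApproximation.
Context {R : realType}.

(* The expectation of [phi] under the binomial law of parameters [n] and [u],
   so that binomial coefficients never appear. *)
Fixpoint bern (u : R) (n : nat) (phi : nat -> R) : R :=
  if n is k.+1 then u * bern u k (phi \o S) + (1 - u) * bern u k phi else phi 0.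

Lemma bern_le (u : R) n (phi psi : nat -> R) : 0 <= u <= 1 ->
  (forall k, phi k <= psi k) -> bern u n phi <= bern u n psi.
Proof.
move=> /andP[u0 u1]; elim: n phi psi => [|n IH] phi psi le_phi_psi //=.
by apply: lerD; apply: ler_wpM2l; rewrite ?subr_ge0//; apply: IH => k /=.
Qed.

Lemma bern_cst (u : R) n (c : R) : bern u n (fun=> c) = c.
Proof. by elim: n => //= n; rewrite /comp => ->; ring. Qed.

Lemma bern_lin (u : R) n (phi psi : nat -> R) (c : R) :
  bern u n (fun k => phi k + c * psi k) = bern u n phi + c * bern u n psi.
Proof.
elim: n phi psi => //= n IH phi psi.
by rewrite /comp (IH (phi \o S) (psi \o S)) IH; ring.
Qed.

(** Variance plus squared bias. The centre [a] is left free because one success in the recursion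
    replaces it by [a - 1]. *)
Lemma bern_variance (u : R) n (a : R) :
  bern u n (fun k => (k%:R - a) ^+ 2) = n%:R * u * (1 - u) + (n%:R * u - a) ^+ 2.
Proof.
elim: n a => [|n IH] a /=; first by ring.
have -> : (fun k => (k%:R - a) ^+ 2) \o S = fun k : nat => (k%:R - (a - 1)) ^+ 2.
  by apply/funext => k /=; rewrite -natr1; congr (_ ^+ 2); ring.
by rewrite !IH -natr1; ring.
Qed.

Context {X : choiceType}.
Implicit Types (us : seq (X -> R)) (l : seq nat).

(** Expectation under a product of independent binomial laws, one for each function of [us]; the
    list passed to [phi] records the numbers of successes. *)
Fixpoint bern_seq us n (x : X) (phi : seq nat -> R) : R :=
  if us is u :: us' then
    bern (u x) n (fun k => bern_seq us' n x (fun l => phi (k :: l)))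
  else phi [::].

(** Lists of the wrong length stop the sum here and give [True] in [grid_close], so that
    [grid_not_close] needs no hypothesis on the length. *)
Fixpoint grid_dev us n (x : X) l : R :=
  match us, l with
  | u :: us', k :: l' => (k%:R / n%:R - u x) ^+ 2 + grid_dev us' n x l'
  | _, _ => 0
  end.

Fixpoint grid_close us n (eta : R) (x : X) l : Prop :=
  match us, l with
  | u :: us', k :: l' => `|k%:R / n%:R - u x| <= eta /\ grid_close us' n eta x l'
  | _, _ => True
  end.

Definition unit_valued us := forall u x, List.In u us -> 0 <= u x <= 1.

Lemma unit_valued_cons (u : X -> R) us : unit_valued (u :: us) ->
  (forall x, 0 <= u x <= 1) /\ unit_valued us.
Proof.
move=> uus; split => [x|v x vus]; first by apply: uus; left.
by apply: uus; right.
Qed.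

Lemma bern_seq_le us n x (phi psi : seq nat -> R) : unit_valued us ->
  (forall l, size l = size us -> phi l <= psi l) ->
  bern_seq us n x phi <= bern_seq us n x psi.
Proof.
elim: us phi psi => [|u us IH] phi psi /=; first by move=> _; exact.
move=> /unit_valued_cons[uI usI] le_phi_psi; apply: bern_le => // k.
by apply: IH => // l sl; apply: le_phi_psi; rewrite /= sl.
Qed.

Lemma bern_seq_cst us n x (c : R) : bern_seq us n x (fun=> c) = c.
Proof.
elim: us => //= u us IH; rewrite -[RHS](bern_cst (u x) n).
by congr bern; apply/funext.
Qed.

Lemma bern_seq_lin us n x (phi psi : seq nat -> R) (c : R) :
  bern_seq us n x (fun l => phi l + c * psi l) =
  bern_seq us n x phi + c * bern_seq us n x psi.
Proof.
elim: us phi psi => //= u us IH phi psi; rewrite -bern_lin.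
by congr bern; apply/funext => k; rewrite -IH.
Qed.

(** Centred at its mean [n u], each coordinate has variance [n u (1 - u)]; division by the square of
    [n] leaves at most [1 / n] per coordinate. *)
Lemma bern_seq_dev us n x : (0 < n)%N -> unit_valued us ->
  bern_seq us n x (grid_dev us n x) <= (size us)%:R / n%:R.
Proof.
move=> n0; elim: us => [|u us IH] /=; first by rewrite mul0r.
move=> /unit_valued_cons[uI usI].
have nR : 0 < n%:R :> R by rewrite ltr0n.
(* The added [0] and the factor [1] give the shape [phi + c * psi] on which [bern_lin] acts. *)
have var k : bern_seq us n x (fun l => (k%:R / n%:R - u x) ^+ 2 + grid_dev us n x l)
    = (0 + (n%:R ^- 2) * (k%:R - n%:R * u x) ^+ 2) + 1 * bern_seq us n x (grid_dev us n x).
  under [X in bern_seq us n x X]eq_fun do rewrite -[grid_dev _ _ _ _]mul1r.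
  rewrite bern_seq_lin bern_seq_cst; congr (_ + _); rewrite add0r.
  by field; rewrite gt_eqF.
under eq_fun do rewrite var.
rewrite bern_lin bern_lin !bern_cst bern_variance add0r mul1r -natr1 mulrDl addrC.
apply: lerD; first exact: IH.
rewrite subrr expr0n addr0 (_ : _ * _ = u x * (1 - u x) / n%:R); last first.
  by field; rewrite gt_eqF.
by rewrite ler_pM2r ?invr_gt0//; have /andP[] := uI x; nra.
Qed.

Lemma grid_dev_ge0 us n x l : 0 <= grid_dev us n x l.
Proof. by elim: us l => [|u us IH] [|k l] //=; rewrite addr_ge0 ?sqr_ge0. Qed.

(** The pointwise form of Chebyshev's inequality: one bad coordinate already contributes
    [eta ^+ 2]. *)
Lemma grid_not_close us n eta x l : 0 <= eta -> ~ grid_close us n eta x l ->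
  eta ^+ 2 <= grid_dev us n x l.
Proof.
move=> eta0; elim: us l => [|u us IH] [|k l] //= /not_andP[/negP|nc].
  rewrite -ltNge => /ltW far; apply: ler_wpDr; first exact: grid_dev_ge0.
  by rewrite -[leRHS]real_normK ?num_real// lerXn2r ?nnegrE.
by apply: ler_wpDl; rewrite ?sqr_ge0// IH.
Qed.

Lemma grid_close_dist us n eta x y l : size l = size us ->
  grid_close us n eta x l -> grid_close us n eta y l ->
  forall u, List.In u us -> `|u x - u y| <= eta + eta.
Proof.
elim: us l => [|v us IH] [|k l] //= [sl] [xk xl] [yk yl] u [<-|]; last exact: IH xl yl _.
rewrite (_ : v x - v y = (k%:R / n%:R - v y) - (k%:R / n%:R - v x)); last by ring.
by apply: (le_trans (ler_normB _ _)); exact: lerD.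
Qed.

Variable A : (X -> R) -> Prop.
Hypothesis A_cst : forall c, A (fun=> c).
Hypothesis A_add : forall f g, A f -> A g -> A (fun x => f x + g x).
Hypothesis A_mul : forall f g, A f -> A g -> A (fun x => f x * g x).

(** [phi] may depend on the point, because in [bern_seq] the inner expectations do. *)
Lemma bern_closed (u : X -> R) n (phi : X -> nat -> R) : A u ->
  (forall k, A (phi ^~ k)) -> A (fun x => bern (u x) n (phi x)).
Proof.
move=> Au; elim: n phi => [|n IH] phi Aphi /=; first exact: Aphi.
apply: A_add; apply: A_mul => //.
- by apply: (IH (fun x => phi x \o S)) => k; exact: Aphi.
- by under eq_fun do rewrite -mulN1r; apply: A_add => //; apply: A_mul.
- by apply: IH.
Qed.

Lemma bern_seq_closed us n (phi : seq nat -> R) :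
  (forall u, List.In u us -> A u) -> A (fun x => bern_seq us n x phi).
Proof.
elim: us phi => [|u us IH] phi Aus /=; first exact: A_cst.
apply: (@bern_closed u n (fun x k => bern_seq us n x (fun l => phi (k :: l)))).
  by apply: Aus; left.
by move=> k; apply: IH => v vus; apply: Aus; right.
Qed.

(* Stone-Weierstrass, with the separation hypothesis in quantitative form. *)
Theorem bernstein_approximation us (f : X -> R) (M : R) (x0 : X) :
  unit_valued us -> (forall u, List.In u us -> A u) ->
  (forall x, `|f x| <= M) ->
  unif_cont_wrt (fun eta x y => forall u, List.In u us -> `|u x - u y| <= eta) f ->
  forall e : R, 0 < e -> exists2 P, A P & forall x, `|f x - P x| <= e.
Proof.
move=> usI Aus fM fmod e e0.
have [eta eta0 feta] := fmod _ (divr_gt0 e0 (ltr0n R 2)).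
(* Two points within [h] of the same grid node have generator values within [h + h = eta]. *)
pose h := eta / 2; have h0 : 0 < h by rewrite divr_gt0.
have M0 : 0 <= M by apply: le_trans (fM x0).
(* At nodes far from [x] the crude bound [2 * M] is at most [C * grid_dev], since [grid_dev] is at
   least [h ^+ 2] there. *)
pose C := 2 * M / h ^+ 2.
have C0 : 0 <= C by rewrite divr_ge0 ?sqr_ge0 ?mulr_ge0.
have [n n0 nC] : exists2 n, (0 < n)%N & C * ((size us)%:R / n%:R) <= e / 2.
  pose b := C * (size us)%:R / (e / 2); have b0 : 0 <= b.
    by apply: divr_ge0; [exact: mulr_ge0|apply/ltW/divr_gt0].
  have [k kb] : exists k : nat, b < k%:R.
    by exists (Num.truncn b).+1; rewrite truncnS_gt.
  have k0 : 0 < k%:R :> R by apply: le_lt_trans kb.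
  exists k; first by move: k0; rewrite ltr0n.
  rewrite mulrA ler_pdivrMr// [leRHS]mulrC -ler_pdivrMr ?divr_gt0//; exact: ltW.
(* A node need not be near the generator values of any point. [xget] then returns [x0], which is
   harmless: such a node is far from every [x], and only the bound [M] is used for it. *)
pose phi l := f (xget x0 [set y | grid_close us n h y l]).
exists (fun x => bern_seq us n x phi); first exact: bern_seq_closed.
move=> x.
have dev l : size l = size us -> `|phi l - f x| <= e / 2 + C * grid_dev us n x l.
  move=> sl; have [cx|ncx] := pselect (grid_close us n h x l).
    apply: ler_wpDr; first by rewrite mulr_ge0// grid_dev_ge0.
    have cy : grid_close us n h (xget x0 [set y | grid_close us n h y l]) l.
      exact: (@xgetPex _ x0 [set y | grid_close us n h y l]) (ex_intro _ x cx).
    apply: feta => u uus.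
    by rewrite (le_trans (grid_close_dist sl cy cx uus))// /h; lra.
  apply: ler_wpDl; first by apply/ltW/divr_gt0.
  apply: (@le_trans _ _ (C * h ^+ 2)); last first.
    by rewrite ler_wpM2l// grid_not_close// ltW.
  rewrite /C divfK ?expf_neq0 ?gt_eqF//.
  apply: (le_trans (ler_normB _ _)).
  by rewrite mulr_natl mulr2n; apply: lerD; exact: fM.
have tot : bern_seq us n x (fun l => e / 2 + C * grid_dev us n x l) <= e.
  rewrite bern_seq_lin bern_seq_cst [leRHS](_ : e = e / 2 + e / 2); last by lra.
  by rewrite lerD2l (le_trans _ nC)// ler_wpM2l// bern_seq_dev.
have up : bern_seq us n x phi <= f x + e.
  rewrite -lerBlDl; apply: le_trans tot.
  have -> : bern_seq us n x phi - f x = bern_seq us n x (fun l => - f x + 1 * phi l).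
    by rewrite bern_seq_lin bern_seq_cst mul1r addrC.
  apply: bern_seq_le => // l sl; rewrite mul1r addrC.
  by apply: (le_trans (ler_norm _)); exact: dev.
have lo : f x - e <= bern_seq us n x phi.
  rewrite lerBlDr -lerBlDl; apply: le_trans tot.
  have -> : f x - bern_seq us n x phi = bern_seq us n x (fun l => f x + (-1) * phi l).
    by rewrite bern_seq_lin bern_seq_cst mulN1r.
  apply: bern_seq_le => // l sl; rewrite mulN1r.
  by apply: (le_trans (ler_norm _)); rewrite distrC; exact: dev.
by rewrite ler_norml; apply/andP; split; lra.
Qed.

End BernsteinApproximation.

(** * Space-time periods and reduction to a compact period cell *)

Section Periodicity.
Context {R : realType}.

Definition is_period {V : zmodType} (f : V -> R) (v : V) :=
  forall p, f (p + v) = f p.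

Section Period.
Context {V : zmodType} (f : V -> R).

Lemma is_period0 : is_period f 0.
Proof. by move=> p; rewrite addr0. Qed.

Lemma is_periodD v w : is_period f v -> is_period f w -> is_period f (v + w).
Proof. by move=> fv fw p; rewrite addrA fw fv. Qed.

Lemma is_periodN v : is_period f v -> is_period f (- v).
Proof. by move=> fv p; rewrite -[LHS]fv addrNK. Qed.

Lemma is_periodMz v (k : int) : is_period f v -> is_period f (v *~ k).
Proof.
move=> fv; have pn n : is_period f (v *+ n).
  by elim: n => [|n IH]; [exact: is_period0|rewrite mulrS; exact: is_periodD].
by case: k => n; [exact: pn|rewrite NegzE mulrNz; apply: is_periodN; exact: pn].
Qed.

Lemma is_period_sum (I : finType) (v : I -> V) (k : I -> int) :
  (forall i, is_period f (v i)) -> is_period f (\sum_i v i *~ k i).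
Proof.
by move=> fv; elim/big_ind: _ => //; [exact: is_period0|exact: is_periodD|
  move=> i _; exact: is_periodMz].
Qed.

End Period.

Context {d : nat} (T : R).
Implicit Types (f : R * 'rV[R]_d -> R) (p q : R * 'rV[R]_d).

Definition st_periodic f :=
  is_period f (T, 0) /\ forall i : 'I_d, is_period f (0, evec R i).

Definition st_lattice (k : int) (n : 'I_d -> int) : R * 'rV[R]_d :=
  (T, 0) *~ k + \sum_i (0, evec R i) *~ n i.

Lemma st_periodic_lattice f k n : st_periodic f -> is_period f (st_lattice k n).
Proof.
move=> [fT fe]; apply: is_periodD; first exact: is_periodMz.
exact: is_period_sum.
Qed.

Lemma st_latticeE k n : st_lattice k n = (T *~ k, \row_i (n i)%:~R).
Proof.
have pairMz (a : R) (b : 'rV[R]_d) (z : int) : (a, b) *~ z = (a *~ z, b *~ z).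
  have pn m : (a, b) *+ m = (a *+ m, b *+ m).
    by elim: m => [|m IH] //; rewrite !mulrS IH.
  by case: z => m; rewrite ?NegzE ?mulrNz -?pmulrn pn.
have sum_pair (v : 'I_d -> 'rV[R]_d) : \sum_i (0 : R, v i) = (0, \sum_i v i).
  by elim/big_rec2: _ => // i y _ _ ->; congr (_, _); rewrite /= addr0.
rewrite /st_lattice; under eq_bigr do rewrite pairMz mul0rz.
rewrite sum_pair pairMz mul0rz; congr (_, _) => /=; first by rewrite addr0.
rewrite add0r; apply/rowP => j; rewrite summxE mxE (bigD1 j)//= big1 => [|i ij].
  by rewrite addr0 -scaler_int !mxE !eqxx mulr1.
by rewrite -scaler_int !mxE eqxx/= eq_sym (negbTE ij) mulr0.
Qed.

Definition st_cube : set (R * 'rV[R]_d) :=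
  `[0, T] `*` [set x : 'rV[R]_d | forall i, `[0, 1]%classic (x ord0 i)].

Lemma st_cube_compact : compact st_cube.
Proof.
apply: compact_setX; first exact: segment_compact.
by apply: (@rV_compact R^o d (fun=> `[0, 1]%classic)) => i; exact: segment_compact.
Qed.

Hypothesis T0 : 0 < T.

Lemma st_cube_nonempty : st_cube !=set0.
Proof.
exists (0, 0); split => /=; first by rewrite in_itv/= lexx ltW.
by move=> i; rewrite mxE in_itv/= lexx ler01.
Qed.

(** The lattice shift depends on [p] alone, so one representative serves all periodic functions at
    once; this allows two of them to be compared at the same [q]. *)
Lemma st_cube_rep p : exists2 q, st_cube q &
  forall f, st_periodic f -> f p = f q.
Proof.
case: p => t x; pose k : int := - Num.floor (t / T).
pose n i : int := - Num.floor (x ord0 i).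
exists ((t, x) + st_lattice k n); last first.
  by move=> f fper; rewrite st_periodic_lattice.
rewrite st_latticeE; split => /= [|i].
  have := floor_itv (t / T); rewrite intrD1.
  have -> : T *~ k = - ((Num.floor (t / T))%:~R * T) by rewrite /k mulrNz mulrzl.
  rewrite in_itv /= => /andP[].
  rewrite ler_pdivlMr// ltr_pdivrMr// => a b.
  by rewrite subr_ge0 a /= lerBlDl ltW// -[X in _ + X]mul1r -mulrDl.
have := floor_itv (x ord0 i); rewrite intrD1.
by rewrite in_itv /= !mxE /n mulrNz subr_ge0 => /andP[-> /ltW b]; rewrite lerBlDl.
Qed.

Lemma st_periodic_max f : continuous f -> st_periodic f ->
  exists p, forall q, f q <= f p.
Proof.
move=> cf fper; have [c _ fc] := compact_EVT_max st_cube_nonempty st_cube_compact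
  (continuous_subspaceT cf).
exists c => q; have [q' q'K ->//] := st_cube_rep q.
by apply: fc; rewrite inE.
Qed.

Lemma st_periodic_bounded f : continuous f -> st_periodic f ->
  exists M, forall p, `|f p| <= M.
Proof.
move=> cf fper; have [p fp] : exists p, forall q, `|f q| <= `|f p|.
  apply: (@st_periodic_max (fun q => `|f q|)) => [x|].
    by apply: continuous_comp; [exact: cf|exact: norm_continuous].
  by case: fper => fT fe; split => [q|i q]; rewrite ?fT ?fe.
by exists `|f p|.
Qed.

(** Compactness of the cell turns a condition holding eventually near each point into one holding
    eventually for all points together. *)
Lemma near_st_cube (I : Type) (F : set_system I) (Q : I -> R * 'rV[R]_d -> Prop) :
  Filter F ->
  (forall p, \forall p' \near p & i \near F, Q i p') ->
  \forall i \near F, forall p, st_cube p -> Q i p.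
Proof.
by move=> FF Qnear; apply: (compact_near_coveringP _).1 st_cube_compact _ _ _ _ _.
Qed.

End Periodicity.

(** * Linearity of the differential operators on [C12per] *)

Section LinearCombinations.
Context {R : realType} {d : nat}.
Implicit Types (g h : 'rV[R]_d -> R) (u v : R -> 'rV[R]_d -> R).

(** The single shape [g + c * h] covers both [psi0 + eps chi] and, with [c = -1], the differences to
    which the maximum principle is applied. *)
Lemma derivable_lin (V : normedModType R) (g h : V -> R) (c : R) (x v : V) :
  derivable g x v -> derivable h x v -> derivable (fun y => g y + c * h y) x v.
Proof. by move=> dg dh; apply: derivableD => //; exact: derivableZ. Qed.

Lemma derive_lin (V : normedModType R) (g h : V -> R) (c : R) (x v : V) :
  derivable g x v -> derivable h x v ->
  'D_v (fun y => g y + c * h y) x = 'D_v g x + c * 'D_v h x.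
Proof.
move=> dg dh; rewrite -[c * 'D_v h x](deriveZ c dh) -deriveD//.
exact: derivableZ.
Qed.

Lemma continuous_lin (X : topologicalType) (g h : X -> R) (c : R) :
  continuous g -> continuous h -> continuous (fun y => g y + c * h y).
Proof.
move=> cg ch x; apply: cvgD; first exact: cg.
by apply: cvgM; [exact: cvg_cst|exact: ch].
Qed.

Variable T : R.

Lemma dt_lin u v c t x : C12per T u -> C12per T v ->
  dt (fun t x => u t x + c * v t x) t x = dt u t x + c * dt v t x.
Proof.
move=> [_ [_ [_ [du _]]]] [_ [_ [_ [dv _]]]].
rewrite /dt !derive1E; exact: derive_lin.
Qed.

Lemma pdx_lin u v c i t : C12per T u -> C12per T v ->
  pdx i (fun x => u t x + c * v t x) = fun x => pdx i (u t) x + c * pdx i (v t) x.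
Proof.
move=> [_ [_ [_ [_ [_ du]]]]] [_ [_ [_ [_ [_ dv]]]]]; apply/funext => x.
by apply: derive_lin; [apply: (du i).1|apply: (dv i).1].
Qed.

Lemma pdx2_lin u v c i j t : C12per T u -> C12per T v ->
  pdx j (pdx i (fun x => u t x + c * v t x)) =
  fun x => pdx j (pdx i (u t)) x + c * pdx j (pdx i (v t)) x.
Proof.
move=> Cu Cv; rewrite (pdx_lin _ _ _ Cu Cv); apply/funext => x.
case: Cu => [_ [_ [_ [_ [_ du]]]]]; case: Cv => [_ [_ [_ [_ [_ dv]]]]].
apply: derive_lin.
  by have [_ [_ /(_ j) [+ _]]] := du i; exact.
by have [_ [_ /(_ j) [+ _]]] := dv i; exact.
Qed.

Lemma C12per_lin u v c : C12per T u -> C12per T v ->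
  C12per T (fun t x => u t x + c * v t x).
Proof.
move=> Cu Cv; have := (Cu, Cv).
move=> [[uT [ux [uc [ud [udc du]]]]] [vT [vx [vc [vd [vdc dv]]]]]].
split; first by move=> t x; rewrite uT vT.
split; first by move=> t i x; rewrite ux vx.
split; first exact: (continuous_lin (c := c) uc vc).
split; first by move=> t x; exact: derivable_lin.
split.
  have -> : (fun p : R * 'rV[R]_d => dt (fun t x => u t x + c * v t x) p.1 p.2) =
      fun p => dt u p.1 p.2 + c * dt v p.1 p.2.
    by apply/funext => p; exact: dt_lin.
  exact: (continuous_lin (c := c) udc vdc).
move=> i; have [ui [uic uij]] := du i; have [vi [vic vij]] := dv i.
split; first by move=> t x; exact: derivable_lin.
split.
  have -> : (fun p : R * 'rV[R]_d => pdx i (fun x => u p.1 x + c * v p.1 x) p.2) =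
      fun p => pdx i (u p.1) p.2 + c * pdx i (v p.1) p.2.
    by apply/funext => p; rewrite (pdx_lin _ _ _ Cu Cv).
  exact: (continuous_lin (c := c) uic vic).
move=> j; have [uji ujc] := uij j; have [vji vjc] := vij j; split.
  by move=> t x; rewrite (pdx_lin _ _ _ Cu Cv); exact: derivable_lin.
have -> : (fun p : R * 'rV[R]_d => pdx j (pdx i (fun x => u p.1 x + c * v p.1 x)) p.2) =
    fun p => pdx j (pdx i (u p.1)) p.2 + c * pdx j (pdx i (v p.1)) p.2.
  by apply/funext => p; rewrite (pdx2_lin _ _ _ _ Cu Cv).
exact: (continuous_lin (c := c) ujc vjc).
Qed.

Lemma gradx_lin u v c t x : C12per T u -> C12per T v ->
  gradx (fun x => u t x + c * v t x) x = gradx (u t) x + c *: gradx (v t) x.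
Proof.
by move=> Cu Cv; apply/rowP => i; rewrite !mxE (pdx_lin _ _ _ Cu Cv).
Qed.

Lemma lapx_lin u v c t x : C12per T u -> C12per T v ->
  lapx (fun x => u t x + c * v t x) x = lapx (u t) x + c * lapx (v t) x.
Proof.
move=> Cu Cv; rewrite /lapx mulr_sumr -big_split/=.
by apply: eq_bigr => i _; rewrite (pdx2_lin _ _ _ _ Cu Cv).
Qed.

Lemma C12per_periodic u : C12per T u -> st_periodic T (fun p => u p.1 p.2).
Proof.
by move=> [uT [ux _]]; split => [p|i p] /=; rewrite ?addr0 ?uT ?ux.
Qed.

End LinearCombinations.

(** * First and second order conditions at a space-time maximum *)

Section MaximumPrinciple.
Context {R : realType}.

Lemma is_derive_line (V : normedModType R) (f : V -> R) (x v : V) (s : R) :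
  derivable f (x + s *: v) v ->
  is_derive s 1 (fun r : R => f (x + r *: v)) ('D_v f (x + s *: v)).
Proof.
move=> df; have E : (fun h : R => h^-1 *: (f (x + (h *: 1 + s) *: v) - f (x + s *: v)))
    = (fun h : R => h^-1 *: (f (h *: v + (x + s *: v)) - f (x + s *: v))).
  apply/funext => h; congr (_ *: (f _ - _)).
  by rewrite [h *: 1]mulr1 scalerDl addrCA.
split; first by rewrite /derivable /= E.
by rewrite /derive /= E.
Qed.

Lemma derive_global_max (g : R -> R) (a : R) : (forall s, derivable g s 1) ->
  (forall s, g s <= g a) -> 'D_1 g a = 0.
Proof.
move=> dg gmax; have ab : a - 1 <= a + 1 by lra.
have ain : a \in `]a - 1, a + 1[ by rewrite in_itv/=; apply/andP; split; lra.
by have [] := derive1_at_max ab (fun t _ => dg t) ain (fun t _ => gmax t).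
Qed.

(** Were [d2] positive, [dg], which vanishes at [0], would be positive just to the right of it, and
    the mean value theorem would give a value of [g] above the maximum. *)
Lemma derive2_global_max (g dg : R -> R) (d2 : R) :
  (forall s : R, is_derive s 1 g (dg s)) -> is_derive (0 : R) 1 dg d2 ->
  (forall s, g s <= g 0) -> d2 <= 0.
Proof.
move=> gd dgd gmax; rewrite leNgt; apply/negP => d20.
have dg0 : dg 0 = 0.
  have [_ <-] := gd 0; exact: derive_global_max.
have quot : (fun h : R => h^-1 *: (dg (h *: 1 + 0) - dg 0)) @ 0^' --> d2.
  have [dgd1 dgd2] := dgd; rewrite -dgd2 /derive /=.
  exact: dgd1.
have : \forall h \near 0^', 0 < h^-1 *: (dg (h *: 1 + 0) - dg 0).
  exact: (cvgr_gt _ quot).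
rewrite /dnbhs /within /= => /nbhs_ballP[r /= r0 Hr].
have dgpos s : 0 < s < r -> 0 < dg s.
  move=> /andP[s0 sr]; have /Hr : ball (0 : R) r s.
    by rewrite /ball/= sub0r normrN gtr0_norm.
  move=> /(_ (lt0r_neq0 s0)); rewrite dg0 subr0 addr0 [s *: 1]mulr1.
  by rewrite pmulr_rgt0// invr_gt0.
pose s := r / 2; have s0 : 0 < s by rewrite divr_gt0.
have gc : {within `[0, s], continuous g}.
  apply: continuous_subspaceT => x; apply: differentiable_continuous.
  by apply/derivable1_diffP; have [] := gd x.
have [c] := MVT s0 (fun x _ => gd x) gc.
rewrite in_itv /= => /andP[c0 cs] E.
have : 0 < dg c * (s - 0).
  rewrite mulr_gt0 ?subr0// dgpos// c0 /= (lt_trans cs)// /s.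
  by rewrite ltr_pdivrMr// ltr_pMr// ltr1n.
by rewrite -E subr_gt0 ltNge gmax.
Qed.

(** By periodicity the maximum over the cell is one over all of space-time. There is no initial or
    final time, so the time derivative vanishes exactly. *)
Lemma C12per_max (d : nat) (T : R) (w : R -> 'rV[R]_d -> R) : 0 < T -> C12per T w ->
  exists t x, [/\ dt w t x = 0, gradx (w t) x = 0 & lapx (w t) x <= 0].
Proof.
move=> T0 Cw; have [_ [_ [wc [wd [_ dw]]]]] := Cw.
have [[t x] wmax] := st_periodic_max T0 wc (C12per_periodic Cw).
have line (i : 'I_d) (s : R) : is_derive s 1 (fun r : R => w t (x + r *: evec R i))
    (pdx i (w t) (x + s *: evec R i)).
  by apply: is_derive_line; apply: (dw i).1.
have lmax i s : w t (x + s *: evec R i) <= w t (x + 0 *: evec R i).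
  by rewrite scale0r addr0; exact: (wmax (t, _)).
exists t, x; split.
- rewrite /dt derive1E; apply: derive_global_max => // s.
  exact: (wmax (s, x)).
- apply/rowP => i; rewrite !mxE -[x in LHS]addr0 -(scale0r (evec R i)).
  have [_ <-] := line i 0; exact: derive_global_max.
- rewrite /lapx -oppr_ge0 -sumrN; apply: sumr_ge0 => i _; rewrite oppr_ge0.
  apply: (derive2_global_max (line i) _ (lmax i)).
  rewrite -[X in pdx i _ X]addr0 -(scale0r (evec R i)); apply: is_derive_line.
  by have [_ [_ /(_ i) [+ _]]] := dw i; exact.
Qed.

End MaximumPrinciple.

(** * Linearity and stability of the iterated integrals *)

Section IteratedIntegrals.
Context {R : realType}.
Notation mu := (@lebesgue_measure R).

Lemma continuous_itv_integrable (h : R -> R) (a b : R) : continuous h ->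
  mu.-integrable `[a, b] (EFin \o h).
Proof.
move=> ch; apply: continuous_compact_integrable; first exact: segment_compact.
exact: continuous_subspaceT.
Qed.

Lemma le_Rintegral_itv (h k : R -> R) (a b : R) : continuous h -> continuous k ->
  (forall s, h s <= k s) ->
  Rintegral mu `[a, b] h <= Rintegral mu `[a, b] k.
Proof. by move=> ch ck hk; apply: le_Rintegral => //; exact: continuous_itv_integrable. Qed.

Lemma Rintegral_itv_lin (h k : R -> R) (c a b : R) : continuous h -> continuous k ->
  Rintegral mu `[a, b] (fun s => h s + c * k s) =
  Rintegral mu `[a, b] h + c * Rintegral mu `[a, b] k.
Proof.
move=> ch ck; have ik := @continuous_itv_integrable k a b ck.
rewrite RintegralD//; last 2 first.
- exact: continuous_itv_integrable.
- apply: (@continuous_itv_integrable (fun s => c * k s)) => s.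
  by apply: cvgM; [exact: cvg_cst|exact: ck].
by rewrite RintegralZl.
Qed.

Lemma Rintegral_itv_cst (c a b : R) : a <= b ->
  Rintegral mu `[a, b] (fun=> c) = c * (b - a).
Proof.
move=> ab; rewrite Rintegral_cst//= lebesgue_measure_itv/= lte_fin.
by case: ltgtP ab => // ->; rewrite subrr.
Qed.

Definition unif_cont1 (h : R -> R) :=
  unif_cont_wrt (fun delta s t => `|s - t| <= delta) h.

Lemma unif_cont1_continuous h : unif_cont1 h -> continuous h.
Proof.
move=> uh s; apply/cvgrPdist_le => e /uh[delta d0 hd].
near=> t; apply: hd; near: t.
by exists delta => //= t; rewrite /ball_ /= => /ltW.
Unshelve. all: by end_near. Qed.

(** Uniform continuity passes to every slice with the same [delta], so the inner integral is again
    continuous in the slicing variable and the outer one makes sense. *)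
Definition unif_cont {d : nat} (f : 'rV[R]_d -> R) :=
  unif_cont_wrt (fun delta (x y : 'rV[R]_d) => forall i, `|x ord0 i - y ord0 i| <= delta) f.

Lemma unif_cont_slice d (f : 'rV[R]_d.+1 -> R) s : unif_cont f ->
  unif_cont (fun y : 'rV[R]_d => f (row_mx (const_mx s : 'rV_1) y)).
Proof.
move=> uf e /uf[delta d0 fd]; exists delta => // x y xy; apply: fd => i.
rewrite !mxE; case: splitP => j _; last exact: xy.
by rewrite mxE subrr normr0 ltW.
Qed.

Lemma unif_cont_lin d (f g : 'rV[R]_d -> R) c : unif_cont f -> unif_cont g ->
  unif_cont (fun x => f x + c * g x).
Proof.
apply: unif_cont_wrt_lin => d1 d2 x y d12 xy i.
exact: le_trans (xy i) d12.
Qed.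

Lemma unif_cont_cst d (c : R) : unif_cont (fun _ : 'rV[R]_d => c).
Proof. by move=> e e0; exists 1 => // x y _; rewrite subrr normr0 ltW. Qed.

Lemma torus_int_cst d (c : R) : torus_int (fun _ : 'rV[R]_d => c) = c.
Proof.
elim: d => [//|d IH] /=; rewrite IH.
by rewrite Rintegral_itv_cst ?ler01// subr0 mulr1.
Qed.

Section Induction.
Variable d : nat.
Hypothesis torus_int_le : forall f g : 'rV[R]_d -> R, unif_cont f -> unif_cont g ->
  (forall x, f x <= g x) -> torus_int f <= torus_int g.
Hypothesis torus_int_lin : forall (f g : 'rV[R]_d -> R) c, unif_cont f -> unif_cont g ->
  torus_int (fun x => f x + c * g x) = torus_int f + c * torus_int g.

(** Integrate [f <= g + e * 1] and its mirror image, the integral of [1] being [1]. The section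
    hypotheses are the induction hypotheses of [torus_int_le_lin]. *)
Lemma torus_int_dist_of_le (f g : 'rV[R]_d -> R) e : unif_cont f -> unif_cont g ->
  (forall x, `|f x - g x| <= e) -> `|torus_int f - torus_int g| <= e.
Proof.
move=> uf ug fg; have u1 := @unif_cont_cst d 1.
have fg' : torus_int f <= torus_int g + e.
  rewrite -[e]mulr1 -(torus_int_cst d 1) -torus_int_lin//; apply: torus_int_le => //.
    exact: unif_cont_lin.
  by move=> x; have := fg x; rewrite ler_norml => /andP[_]; lra.
have gf' : torus_int g <= torus_int f + e.
  rewrite -[e]mulr1 -(torus_int_cst d 1) -torus_int_lin//; apply: torus_int_le => //.
    exact: unif_cont_lin.
  by move=> x; have := fg x; rewrite ler_norml => /andP[+ _]; lra.
by rewrite ler_norml; apply/andP; split; lra.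
Qed.

Lemma continuous_torus_int_slice (f : 'rV[R]_d.+1 -> R) : unif_cont f ->
  continuous (fun s => torus_int (fun y : 'rV[R]_d => f (row_mx (const_mx s : 'rV_1) y))).
Proof.
move=> uf; apply: unif_cont1_continuous => e /uf[delta d0 fd]; exists delta => // s t st.
apply: torus_int_dist_of_le => [||y]; try exact: unif_cont_slice.
apply: fd => i; rewrite !mxE; case: splitP => j _; first by rewrite !mxE.
by rewrite subrr normr0 ltW.
Qed.

End Induction.

(** Monotonicity and linearity go up in dimension together: each needs the slice integrals to be
    continuous, and that continuity uses both in the lower dimension. *)
Lemma torus_int_le_lin d :
  (forall f g : 'rV[R]_d -> R, unif_cont f -> unif_cont g ->
    (forall x, f x <= g x) -> torus_int f <= torus_int g) /\
  (forall (f g : 'rV[R]_d -> R) c, unif_cont f -> unif_cont g ->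
    torus_int (fun x => f x + c * g x) = torus_int f + c * torus_int g).
Proof.
elim: d => [|d [le_d lin_d]]; first by split => //= f g _ _; exact.
have cs := continuous_torus_int_slice le_d lin_d.
split => [f g uf ug fg|f g c uf ug] /=.
  apply: le_Rintegral_itv; [exact: cs|exact: cs|].
  by move=> s; apply: le_d => //; exact: unif_cont_slice.
rewrite -Rintegral_itv_lin; [|exact: cs|exact: cs].
by congr Rintegral; apply/funext => s; apply: lin_d; exact: unif_cont_slice.
Qed.

Lemma torus_int_lin d (f g : 'rV[R]_d -> R) c : unif_cont f -> unif_cont g ->
  torus_int (fun x => f x + c * g x) = torus_int f + c * torus_int g.
Proof. exact: (torus_int_le_lin d).2. Qed.

Lemma torus_int_dist d (f g : 'rV[R]_d -> R) e : unif_cont f -> unif_cont g ->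
  (forall x, `|f x - g x| <= e) -> `|torus_int f - torus_int g| <= e.
Proof. by have [le_d lin_d] := torus_int_le_lin d; exact: torus_int_dist_of_le. Qed.

Context {d : nat} {T : R}.
Hypothesis T0 : 0 < T.
Implicit Types f g : R * 'rV[R]_d -> R.

Definition st_close (delta : R) (p q : R * 'rV[R]_d) :=
  `|p.1 - q.1| <= delta /\ forall i, `|p.2 ord0 i - q.2 ord0 i| <= delta.

Definition st_unif_cont f := unif_cont_wrt st_close f.

Lemma st_unif_cont_slice f t : st_unif_cont f -> unif_cont (fun x => f (t, x)).
Proof.
move=> uf e /uf[delta d0 fd]; exists delta => // x y xy; apply: fd; split => //=.
by rewrite subrr normr0 ltW.
Qed.

Lemma st_unif_cont_lin f g c : st_unif_cont f -> st_unif_cont g ->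
  st_unif_cont (fun p => f p + c * g p).
Proof.
apply: unif_cont_wrt_lin => d1 d2 p q d12 [pq1 pq2]; split; first exact: le_trans d12.
by move=> i; exact: le_trans (pq2 i) d12.
Qed.

Lemma continuous_torus_int f : st_unif_cont f ->
  continuous (fun t => torus_int (fun x => f (t, x))).
Proof.
move=> uf; apply: unif_cont1_continuous => e /uf[delta d0 fd]; exists delta => // s t st.
apply: torus_int_dist => [||y]; try exact: st_unif_cont_slice.
by apply: fd; split => //= i; rewrite subrr normr0 ltW.
Qed.

Lemma st_mean_lin f g c : st_unif_cont f -> st_unif_cont g ->
  st_mean T (fun t x => f (t, x) + c * g (t, x)) =
  st_mean T (fun t x => f (t, x)) + c * st_mean T (fun t x => g (t, x)).
Proof.
move=> uf ug; rewrite /st_mean mulrA -mulrDl; congr (_ / T); rewrite /st_int.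
rewrite -Rintegral_itv_lin; try exact: continuous_torus_int.
by congr Rintegral; apply/funext => t; apply: torus_int_lin; exact: st_unif_cont_slice.
Qed.

Lemma st_mean_dist f g e : st_unif_cont f -> st_unif_cont g ->
  (forall p, `|f p - g p| <= e) ->
  `|st_mean T (fun t x => f (t, x)) - st_mean T (fun t x => g (t, x))| <= e.
Proof.
move=> uf ug fg; rewrite /st_mean -mulrBl normrM [`|T^-1|]gtr0_norm ?invr_gt0//.
rewrite ler_pdivrMr// /st_int.
pose F t := torus_int (fun x => f (t, x)); pose G t := torus_int (fun x => g (t, x)).
have cF : continuous F := continuous_torus_int uf.
have cG : continuous G := continuous_torus_int ug.
have FG t : `|F t - G t| <= e.
  by apply: torus_int_dist; try exact: st_unif_cont_slice.
have ce : continuous (fun _ : R => e) by move=> x; exact: cvg_cst.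
have intDe (h : R -> R) : continuous h -> Rintegral mu `[0, T] h + e * T =
    Rintegral mu `[0, T] (fun s => h s + 1 * e).
  move=> ch; rewrite Rintegral_itv_lin// Rintegral_itv_cst ?ltW//.
  by rewrite subr0 mul1r.
have cDe (h : R -> R) : continuous h -> continuous (fun s => h s + 1 * e).
  by move=> ch; exact: (@continuous_lin _ _ h (fun=> e) 1).
have up : Rintegral mu `[0, T] F <= Rintegral mu `[0, T] G + e * T.
  rewrite intDe//; apply: le_Rintegral_itv => //; first exact: cDe.
  by move=> s; have := FG s; rewrite ler_norml mul1r => /andP[]; lra.
have lo : Rintegral mu `[0, T] G <= Rintegral mu `[0, T] F + e * T.
  rewrite intDe//; apply: le_Rintegral_itv => //; first exact: cDe.
  by move=> s; have := FG s; rewrite ler_norml mul1r => /andP[]; lra.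
by rewrite ler_norml; apply/andP; split; rewrite -/F -/G; lra.
Qed.

End IteratedIntegrals.

(** * Real Fourier modes on the space-time torus *)

Section Waves.
Context {R : realType}.
Notation mu := (@lebesgue_measure R).

Lemma is_derive_comp_affine (F dF : R -> R) (w b s : R) :
  (forall x : R, is_derive x 1 F (dF x)) ->
  is_derive s 1 (fun r : R => F (w * r + b)) (dF (w * s + b) * w).
Proof.
move=> FdF; pose g r := w * r + b.
have dg : is_derive s 1 g w.
  by apply: is_derive_eq; rewrite /GRing.scale/= mulr1 !(addr0, mulr0, add0r, scaler0).
have dF' : derivable F (g s) 1 by have [] := FdF (g s).
have dg' : derivable g s 1 by have [] := dg.
split.
  apply/derivable1_diffP; apply: (@differentiable_comp _ _ _ _ g F).
    exact/derivable1_diffP.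
  exact/derivable1_diffP.
rewrite -derive1E (_ : (fun r => F (w * r + b)) = F \o g)// derive1_comp//.
by rewrite !derive1E; congr (_ * _); [have [] := FdF (g s)|have [] := dg].
Qed.

(** Writing the derivative as a cosine advanced by a quarter turn keeps the family of waves closed
    under differentiation, with no separate sines. *)
Lemma is_derive_cos_affine (w b s : R) :
  is_derive s 1 (fun r : R => cos (w * r + b)) (w * cos (w * s + b + pi / 2)).
Proof.
rewrite (_ : w * _ = - sin (w * s + b) * w); last by rewrite cosDpihalf mulrC.
exact: (@is_derive_comp_affine cos (fun x => - sin x) w b s (fun x => is_derive_cos x)).
Qed.

Lemma cos_sin_int_period (k : int) :
  is_period (@cos R) (2 * pi * k%:~R) /\ is_period (@sin R) (2 * pi * k%:~R).
Proof.
have -> : 2 * pi * k%:~R = (pi *+ 2) *~ k :> R.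
  by rewrite -[RHS]mulrzr mulr_natl.
by split; apply: is_periodMz => x; rewrite ?cosD2pi ?sinD2pi.
Qed.

Lemma cos_2piK (k : int) (a : R) : cos (2 * pi * k%:~R + a) = cos a.
Proof. by rewrite addrC; exact: (cos_sin_int_period k).1. Qed.

Lemma sin_2piK (k : int) (a : R) : sin (2 * pi * k%:~R + a) = sin a.
Proof. by rewrite addrC; exact: (cos_sin_int_period k).2. Qed.

Lemma continuous_cos_affine (w b : R) : continuous (fun s => cos (w * s + b)).
Proof.
move=> s; apply: differentiable_continuous; apply/derivable1_diffP.
by have [] := is_derive_cos_affine w b s.
Qed.

Lemma Rintegral_cos (k : int) (L b : R) : 0 < L ->
  Rintegral mu `[0, L] (fun s => cos (2 * pi * k%:~R / L * s + b)) =
  if k == 0 then L * cos b else 0.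
Proof.
move=> L0; case: eqVneq => [->|k0].
  rewrite (_ : (fun s : R => _) = fun=> cos b); last first.
    by apply/funext => s; rewrite mulr0 !mul0r add0r.
  by rewrite Rintegral_itv_cst ?ltW// subr0 mulrC.
set w := 2 * pi * k%:~R / L.
have kR : k%:~R != 0 :> R by rewrite intr_eq0.
have w0 : w != 0.
  have pi0 : pi != 0 :> R by rewrite gt_eqF// pi_gt0.
  by rewrite mulf_neq0// ?invr_eq0 ?(gt_eqF L0)// !mulf_neq0// pnatr_eq0.
pose F s : R := w^-1 * sin (w * s + b).
have dF (s : R) : is_derive s 1 F (cos (w * s + b)).
  have := @is_derive_comp_affine sin cos w b s (fun x => is_derive_sin x) => H.
  have := is_deriveZ (w^-1) H; rewrite /GRing.scale/= => H'.
  by apply: is_derive_eq; rewrite mulrC mulfK.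
have cF : continuous F.
  by move=> s; apply: differentiable_continuous; apply/derivable1_diffP; have [] := dF s.
rewrite /Rintegral (continuous_FTC2 L0 (F := F)).
- rewrite /= /F /w mulr0 add0r divfK ?gt_eqF// sin_2piK.
  by rewrite subrr.
- exact/continuous_subspaceT/continuous_cos_affine.
- split => [s _||]; first by have [] := dF s.
    by apply: cvg_at_right_filter; exact: cF.
  by apply: cvg_at_left_filter; exact: cF.
- by move=> s _; rewrite derive1E; have [] := dF s.
Qed.

Definition dotz d (n : 'I_d -> int) (x : 'rV[R]_d) : R :=
  \sum_(i < d) (n i)%:~R * x ord0 i.

Lemma dotzD d (n : 'I_d -> int) x y : dotz n (x + y) = dotz n x + dotz n y.
Proof.
by rewrite /dotz -big_split/=; apply: eq_bigr => i _; rewrite !mxE mulrDr.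
Qed.

Lemma dotzDl d (n n' : 'I_d -> int) x :
  dotz (fun i => n i + n' i) x = dotz n x + dotz n' x.
Proof.
by rewrite /dotz -big_split/=; apply: eq_bigr => i _; rewrite intrD mulrDl.
Qed.

Lemma dotzBl d (n n' : 'I_d -> int) x :
  dotz (fun i => n i - n' i) x = dotz n x - dotz n' x.
Proof.
by rewrite /dotz -sumrB; apply: eq_bigr => i _; rewrite intrB mulrBl.
Qed.

Lemma dotz_line d (n : 'I_d -> int) x (r : R) i :
  dotz n (x + r *: evec R i) = (n i)%:~R * r + dotz n x.
Proof.
rewrite dotzD addrC; congr (_ + _); rewrite /dotz (bigD1 i)//= big1 => [|j ji].
  by rewrite !mxE !eqxx mulr1 addr0.
by rewrite !mxE (negbTE ji) andbF !mulr0.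
Qed.

Lemma dotz_row_mx d (n : 'I_d.+1 -> int) (s : R) (y : 'rV[R]_d) :
  dotz n (row_mx (const_mx s : 'rV_1) y) =
  (n ord0)%:~R * s + dotz (fun i => n (lift ord0 i)) y.
Proof.
rewrite /dotz big_ord_recl; congr (_ * _ + _).
  by rewrite mxE; case: splitP => [j _|j //]; rewrite mxE.
apply: eq_bigr => i _; rewrite mxE; case: splitP => [[[]]//|k].
by rewrite /= /bump leq0n !add1n => -[/ord_inj ->].
Qed.

(** The shift [b] is general because slicing moves the contribution of the first coordinate into
    it. *)
Lemma torus_int_cos d (n : 'I_d -> int) (b : R) :
  torus_int (fun x => cos (2 * pi * dotz n x + b)) =
  if [forall i, n i == 0] then cos b else 0.
Proof.
elim: d n b => [|d IH] n b /=.
  have -> : [forall i, n i == 0] by apply/forallP => -[].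
  by rewrite /dotz big_ord0 mulr0 add0r.
pose n' i := n (lift ord0 i).
have slice s : torus_int (fun y : 'rV_d => cos (2 * pi *
      dotz n (row_mx (const_mx s : 'rV_1) y) + b)) =
    if [forall i, n' i == 0] then cos (2 * pi * (n ord0)%:~R / 1 * s + b) else 0.
  rewrite -IH; congr torus_int; apply/funext => y; congr cos.
  by rewrite dotz_row_mx divr1 -/n'; ring.
under eq_Rintegral do rewrite slice.
have -> : [forall i, n i == 0] = (n ord0 == 0) && [forall i, n' i == 0].
  apply/forallP/andP => [n0|[n0 /forallP n'0] i].
    by split; [exact: n0|apply/forallP => i; exact: n0].
  by case: (unliftP ord0 i) => [j ->|->//]; exact: n'0.
case: [forall i, n' i == 0]; last first.
  by rewrite andbF Rintegral_itv_cst ?ler01// mul0r.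
by rewrite andbT Rintegral_cos// mul1r.
Qed.

Context {d : nat} (T : R).

Definition phase (k : int) (n : 'I_d -> int) (p : R * 'rV[R]_d) : R :=
  2 * pi * k%:~R / T * p.1 + 2 * pi * dotz n p.2.

(** The free shift [a] puts sines and cosines of one frequency into a single real family, which also
    makes the product formula [waveM] uniform. *)
Definition wave k n (a : R) (p : R * 'rV[R]_d) : R := cos (phase k n p + a).

Lemma st_mean_wave k n a : 0 < T ->
  st_mean T (fun t x => wave k n a (t, x)) =
  if (k == 0) && [forall i, n i == 0] then cos a else 0.
Proof.
move=> T0; rewrite /st_mean /st_int.
have slice t : torus_int (fun x => wave k n a (t, x)) =
    if [forall i, n i == 0] then cos (2 * pi * k%:~R / T * t + a) else 0.
  by rewrite -torus_int_cos; congr torus_int; apply/funext => x; congr cos;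
     rewrite /phase/=; ring.
under eq_Rintegral do rewrite slice.
case: [forall i, n i == 0]; last first.
  by rewrite andbF Rintegral_itv_cst ?ltW// !mul0r.
rewrite andbT Rintegral_cos//; case: eqP => _; last by rewrite mul0r.
by rewrite mulrC mulKf ?gt_eqF.
Qed.

Lemma waveM k n a k' n' a' p : wave k n a p * wave k' n' a' p =
  1 / 2 * wave (k + k') (fun i => n i + n' i) (a + a') p +
  1 / 2 * wave (k - k') (fun i => n i - n' i) (a - a') p.
Proof.
have E1 : phase (k + k') (fun i => n i + n' i) p + (a + a') =
    (phase k n p + a) + (phase k' n' p + a').
  by rewrite /phase dotzDl intrD; ring.
have E2 : phase (k - k') (fun i => n i - n' i) p + (a - a') =
    (phase k n p + a) - (phase k' n' p + a').
  by rewrite /phase dotzBl intrB; ring.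
rewrite /wave E1 E2; move: (_ + a) (_ + a') => A B.
by rewrite cosB cosD; field.
Qed.

Lemma cos_lipschitz (a b : R) : `|cos a - cos b| <= `|a - b|.
Proof.
wlog ab : a b / a <= b.
  by move=> H; case: (leP a b) => [/H//|/ltW/H]; rewrite distrC [leRHS]distrC.
have [|c _ E] := @MVT_segment _ cos (fun x => - sin x) a b ab (fun x _ => is_derive_cos x).
  exact/continuous_subspaceT/continuous_cos.
rewrite distrC E normrM normrN [leRHS]distrC ler_piMl//.
exact: sin_max.
Qed.

Lemma wave_unif_cont k n a : st_unif_cont (wave k n a).
Proof.
(* [C] is a Lipschitz constant of the phase for [st_close]. Dividing by [C + 1] below covers the
   constant wave, for which [C] is [0]. *)
move=> e e0; pose C := `|2 * pi * k%:~R / T| + 2 * pi * \sum_i `|(n i)%:~R : R|.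
have pi2 : 0 <= 2 * pi :> R by rewrite mulr_ge0 ?pi_ge0.
have C0 : 0 <= C by rewrite addr_ge0// mulr_ge0// sumr_ge0.
have C1 : 0 < C + 1 by lra.
exists (e / (C + 1)) => [|p q [pq1 pq2]]; first by rewrite divr_gt0.
set delta := e / (C + 1) in pq1 pq2.
have delta0 : 0 <= delta by rewrite ltW// divr_gt0.
apply: (le_trans (cos_lipschitz _ _)).
apply: (@le_trans _ _ (C * delta)); last first.
  by rewrite /delta mulrA ler_pdivrMr// mulrC ler_pM2l// lerDl.
rewrite (_ : _ - _ = 2 * pi * k%:~R / T * (p.1 - q.1) +
    2 * pi * (dotz n p.2 - dotz n q.2)); last by rewrite /phase; ring.
apply: (le_trans (ler_normD _ _)); rewrite [leRHS]mulrDl; apply: lerD.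
  by rewrite normrM ler_wpM2l.
rewrite normrM ger0_norm// -[leRHS]mulrA; apply: ler_wpM2l => //.
rewrite /dotz -sumrB mulr_suml.
apply: (le_trans (ler_norm_sum _ _ _)); apply: ler_sum => i _.
by rewrite -mulrBr normrM ler_wpM2l.
Qed.

Lemma wave_continuous k n a : continuous (wave k n a).
Proof.
have ct : continuous (fun p : R * 'rV[R]_d => p.1) by move=> p; exact: cvg_fst.
have cdot : continuous (fun p : R * 'rV[R]_d => dotz n p.2).
  move=> p; apply: cvg_big => [|i _]; first exact: add_continuous.
  apply: cvgM; first exact: cvg_cst.
  apply: (@cvg_comp _ _ _ snd (fun x : 'rV[R]_d => x ord0 i)); first exact: cvg_snd.
  exact: coord_continuous.
move=> p; apply: (@cvg_comp _ _ _ (fun p => phase k n p + a) cos); last exact: continuous_cos.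
apply: cvgD; last exact: cvg_cst.
by apply: cvgD; (apply: cvgM; first exact: cvg_cst); [exact: ct|exact: cdot].
Qed.

Lemma wave_line k n a t x (r : R) i :
  wave k n a (t, x + r *: evec R i) = cos (2 * pi * (n i)%:~R * r + (phase k n (t, x) + a)).
Proof. by rewrite /wave /phase/= dotz_line; congr cos; ring. Qed.

Lemma is_derive_of_line (V : normedModType R) (f : V -> R) (x v : V) (l : R) :
  is_derive (0 : R) 1 (fun r : R => f (x + r *: v)) l -> is_derive x v f l.
Proof.
have E : (fun h : R => h^-1 *: (f (x + (h *: 1 + (0 : R)) *: v) - f (x + (0 : R) *: v)))
    = (fun h : R => h^-1 *: (f (h *: v + x) - f x)).
  apply/funext => h; rewrite scale0r !addr0.
  by rewrite [h *: 1]mulr1 [h *: v + x]addrC.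
move=> [d1 d2]; split; first by move: d1; rewrite /derivable /= E.
by rewrite -d2 /derive /= E.
Qed.

Lemma is_derive_wave_x k n a (t : R) (x : 'rV[R]_d) i :
  is_derive x (evec R i) (fun y => wave k n a (t, y))
    (2 * pi * (n i)%:~R * wave k n (a + pi / 2) (t, x)).
Proof.
apply: is_derive_of_line; under eq_fun do rewrite wave_line.
have := is_derive_cos_affine (2 * pi * (n i)%:~R) (phase k n (t, x) + a) 0.
by rewrite mulr0 add0r /wave addrA.
Qed.

Lemma is_derive_wave_t k n a (t : R) (x : 'rV[R]_d) :
  is_derive t 1 (fun s => wave k n a (s, x))
    (2 * pi * k%:~R / T * wave k n (a + pi / 2) (t, x)).
Proof.
rewrite (_ : (fun s => _) = fun s => cos (2 * pi * k%:~R / T * s + (2 * pi * dotz n x + a))).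
  rewrite (_ : wave _ _ _ _ =
      cos (2 * pi * k%:~R / T * t + (2 * pi * dotz n x + a) + pi / 2)).
    exact: is_derive_cos_affine.
  by congr cos; rewrite /phase/=; ring.
by apply/funext => s; rewrite /wave /phase addrA.
Qed.

Lemma pdx_wave k n a t i : pdx i (fun y => wave k n a (t, y)) =
  fun x => 2 * pi * (n i)%:~R * wave k n (a + pi / 2) (t, x).
Proof. by apply/funext => x; have [] := is_derive_wave_x k n a t x i. Qed.

Lemma pdx2_wave k n a t i j : pdx j (pdx i (fun y => wave k n a (t, y))) =
  fun x => - ((2 * pi) ^+ 2 * (n i)%:~R * (n j)%:~R * wave k n a (t, x)).
Proof.
rewrite pdx_wave; apply/funext => x.
have := is_deriveZ (2 * pi * (n i)%:~R) (is_derive_wave_x k n (a + pi / 2) t x j).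
move=> [_ E]; rewrite /pdx [LHS]E /GRing.scale/= /wave addrA !addrA !cosDpihalf sinDpihalf.
ring.
Qed.

Lemma wave_C12per k n a : 0 < T -> C12per T (fun t x => wave k n a (t, x)).
Proof.
move=> T0.
have scaled c k' n' a' : continuous (fun p => c * wave k' n' a' p).
  by move=> p; apply: cvgM; [exact: cvg_cst|exact: wave_continuous].
split.
  move=> t x; rewrite /wave -[RHS](cos_2piK k); congr cos; rewrite /phase/=.
  by field; rewrite gt_eqF.
split.
  move=> t i x; rewrite -[evec R i]scale1r wave_line /wave mulr1 cos_2piK.
  by [].
have etaW : (fun p => wave k n a (p.1, p.2)) = wave k n a by apply/funext => -[].
split; first by rewrite etaW; exact: wave_continuous.
split; first by move=> t x; have [] := is_derive_wave_t k n a t x.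
split.
  rewrite (_ : (fun p => _) = fun p => 2 * pi * k%:~R / T * wave k n (a + pi / 2) p)//.
  by apply/funext => -[t x]; rewrite /dt derive1E; have [] := is_derive_wave_t k n a t x.
move=> i; split; first by move=> t x; have [] := is_derive_wave_x k n a t x i.
split.
  rewrite (_ : (fun p => _) = fun p => 2 * pi * (n i)%:~R * wave k n (a + pi / 2) p)//.
  by apply/funext => -[t x]; rewrite pdx_wave.
move=> j; split.
  move=> t x; rewrite pdx_wave.
  by have [] := is_deriveZ (2 * pi * (n i)%:~R) (is_derive_wave_x k n (a + pi / 2) t x j).
rewrite (_ : (fun p => _) =
    fun p => - ((2 * pi) ^+ 2 * (n i)%:~R * (n j)%:~R) * wave k n a p)//.
by apply/funext => -[t x]; rewrite pdx2_wave mulNr.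
Qed.

Lemma dt_wave k n a t x : dt (fun t x => wave k n a (t, x)) t x =
  2 * pi * k%:~R / T * wave k n (a + pi / 2) (t, x).
Proof. by rewrite /dt derive1E; have [] := is_derive_wave_t k n a t x. Qed.

Lemma lapx_wave k n a t x : lapx (fun x => wave k n a (t, x)) x =
  - ((2 * pi) ^+ 2 * (\sum_i (n i)%:~R ^+ 2) * wave k n a (t, x)).
Proof.
rewrite /lapx; under eq_bigr do rewrite pdx2_wave.
rewrite sumrN mulr_sumr mulr_suml; congr (- _); apply: eq_bigr => i _.
by rewrite expr2 !mulrA.
Qed.

End Waves.

(** * Trigonometric polynomials: heat equation and density *)

Section TrigonometricApproximation.
Context {R : realType} {d : nat} (T : R).
Hypothesis T0 : 0 < T.
Implicit Types f g P : R * 'rV[R]_d -> R.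

Inductive trig : (R * 'rV[R]_d -> R) -> Prop :=
| trig_wave k n a : trig (wave T k n a)
| trig_add f g : trig f -> trig g -> trig (fun p => f p + g p)
| trig_scale c f : trig f -> trig (fun p => c * f p).

Lemma trig_cst c : trig (fun=> c).
Proof.
rewrite (_ : (fun=> c) = fun p => c * wave T 0 (fun=> 0) 0 p).
  exact/trig_scale/trig_wave.
apply/funext => p; rewrite /wave /phase /dotz big1 => [|i _]; last by rewrite mul0r.
by rewrite !(mulr0, mul0r, addr0) cos0 mulr1.
Qed.

Lemma trig_mul f g : trig f -> trig g -> trig (fun p => f p * g p).
Proof.
move=> tf; elim: tf g => [k n a|f1 f2 _ IH1 _ IH2|c f1 _ IH] g tg.
- elim: tg => [k' n' a'|g1 g2 _ IH1 _ IH2|c g1 _ IH].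
  + under eq_fun do rewrite waveM.
    by apply: trig_add; apply: trig_scale; exact: trig_wave.
  + by under eq_fun do rewrite mulrDr; exact: trig_add.
  + by under eq_fun do rewrite mulrCA; exact: trig_scale.
- by under eq_fun do rewrite mulrDl; apply: trig_add; [exact: IH1|exact: IH2].
- by under eq_fun do rewrite -mulrA; apply: trig_scale; exact: IH.
Qed.

Lemma trig_unif_cont f : trig f -> st_unif_cont f.
Proof.
(* Writing [c * g] as [g + (c - 1) * g] makes it a case of the lemma on linear combinations. *)
have scale c g : st_unif_cont g -> st_unif_cont (fun p => c * g p).
  move=> ug; rewrite (_ : (fun p => _) = fun p => g p + (c - 1) * g p).
    exact: st_unif_cont_lin.
  by apply/funext => p; ring.
elim=> [k n a|f1 f2 _ u1 _ u2|c f1 _ u1]; first exact: wave_unif_cont.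
- by under eq_fun do rewrite -[f2 _]mul1r; exact: st_unif_cont_lin.
- exact: scale.
Qed.

(** The mean on the right is the compatibility condition: [dt chi - lapx chi] has zero mean over a
    period cell. *)
Definition heat_solvable P := exists2 chi : R -> 'rV[R]_d -> R, C12per T chi &
  forall t x, dt chi t x - lapx (chi t) x = st_mean T (fun t x => P (t, x)) - P (t, x).

Lemma heat_solvable_lin P Q c : st_unif_cont P -> st_unif_cont Q ->
  heat_solvable P -> heat_solvable Q -> heat_solvable (fun p => P p + c * Q p).
Proof.
move=> uP uQ [u Cu Pu] [v Cv Qv]; exists (fun t x => u t x + c * v t x).
  exact: C12per_lin.
move=> t x; rewrite (dt_lin _ _ _ Cu Cv) (lapx_lin _ _ _ Cu Cv).
rewrite (@st_mean_lin _ _ T P Q c uP uQ).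
transitivity ((dt u t x - lapx (u t) x) + c * (dt v t x - lapx (v t) x)).
  by rewrite mulrBr opprD addrACA.
by rewrite Pu Qv mulrBr opprD addrACA.
Qed.

(** With [W] the wave and [W'] its quarter-turn advance, the heat operator sends [W] to [q W + w W']
    and [W'] to [q W' - w W]. Solving for [- W] gives [(- q W + w W') / (q ^+ 2 + w ^+ 2)], which is
    division by [q + i w] in real form; the denominator vanishes only for the constant mode. *)
Lemma wave_heat_solvable k n a : heat_solvable (wave T k n a).
Proof.
pose w : R := 2 * pi * k%:~R / T; pose q : R := (2 * pi) ^+ 2 * \sum_i (n i)%:~R ^+ 2.
have pi2 : 2 * pi != 0 :> R by rewrite mulf_neq0 ?pnatr_eq0// gt_eqF// pi_gt0.
have [/andP[/eqP k0 /forallP n0]|kn] := boolP ((k == 0) && [forall i, n i == 0]).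
  have q0 : q = 0.
    by rewrite /q big1 ?mulr0// => i _; rewrite (eqP (n0 i)) expr0n.
  (* For the constant mode both sides are zero, so a constant function serves. *)
  exists (fun t x => wave T k n a (t, x)); first exact: wave_C12per.
  move=> t x; rewrite dt_wave lapx_wave st_mean_wave// -/q q0 mul0r oppr0 subr0.
  rewrite k0 eqxx mulr0 !mul0r /=; move/forallP: n0 => /[dup] n0 ->.
  rewrite /wave /phase /dotz big1 ?(mulr0, mul0r, add0r) ?subrr// => i _.
  by rewrite (eqP (forallP n0 i)) mul0r.
have D0 : q ^+ 2 + w ^+ 2 != 0.
  apply: contra kn; rewrite paddr_eq0 ?sqr_ge0// !sqrf_eq0 => /andP[q0 w0].
  apply/andP; split.
    move: w0; rewrite /w mulf_eq0 invr_eq0 (gt_eqF T0) orbF mulf_eq0 (negbTE pi2).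
    by rewrite intr_eq0.
  move: q0; rewrite /q mulf_eq0 sqrf_eq0 (negbTE pi2)/= psumr_eq0 => [|i _].
    move/allP => n0; apply/forallP => i; have := n0 i (mem_index_enum _).
    by rewrite /= sqrf_eq0 intr_eq0.
  exact: sqr_ge0.
pose D := q ^+ 2 + w ^+ 2.
pose u t x := wave T k n a (t, x); pose v t x := wave T k n (a - pi / 2) (t, x).
have Cu : C12per T u := wave_C12per k n a T0.
have Cv : C12per T v := wave_C12per k n (a - pi / 2) T0.
have Cuv := C12per_lin (- (q / D) - 1) Cu Cu.
(* The bracket is [- (q / D) * u] in the shape accepted by [C12per_lin]. Since [v] is delayed by a
   quarter turn it equals [- W'], whence the sign of its coefficient. *)
exists (fun t x => (u t x + (- (q / D) - 1) * u t x) + (- (w / D)) * v t x).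
  exact: C12per_lin.
move=> t x; rewrite (dt_lin _ _ _ Cuv Cv) (lapx_lin _ _ _ Cuv Cv).
rewrite (dt_lin _ _ _ Cu Cu) (lapx_lin _ _ _ Cu Cu) !dt_wave !lapx_wave -/w -/q.
rewrite st_mean_wave// (negbTE kn) subrK.
have -> : wave T k n (a - pi / 2) (t, x) = - wave T k n (a + pi / 2) (t, x).
  by rewrite /wave !addrA cosDpihalf cosBpihalf opprK.
by rewrite /D; field.
Qed.

Lemma trig_heat_solvable P : trig P -> heat_solvable P.
Proof.
elim=> [k n a|f g tf hf tg hg|c f tf hf]; first exact: wave_heat_solvable.
- under eq_fun do rewrite -[g _]mul1r.
  by apply: heat_solvable_lin => //; exact: trig_unif_cont.
- rewrite (_ : (fun p => _) = fun p => f p + (c - 1) * f p).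
    by apply: heat_solvable_lin => //; exact: trig_unif_cont.
  by apply/funext => p; ring.
Qed.

Definition coordinate (o : option 'I_d) (p : R * 'rV[R]_d) : R :=
  if o is Some i then p.2 ord0 i else p.1 / T.

(* [(1 + cos (2 pi c)) / 2] and [(1 + sin (2 pi c)) / 2] for each normalized
   coordinate [c]; together they embed the torus in a cube. *)
Definition generator (b : bool * option 'I_d) (p : R * 'rV[R]_d) : R :=
  1 / 2 * (1 + wave T (b.2 == None) (fun j => (b.2 == Some j : nat))
    (if b.1 then 0 else - (pi / 2)) p).

Lemma phase_coordinate o p :
  phase T (o == None) (fun j => (o == Some j : nat)) p = 2 * pi * coordinate o p.
Proof.
rewrite /phase /dotz; case: o => [i|].
  rewrite (_ : (Some i == None) = false)// (bigD1 i)//= big1 => [|j ji].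
    by rewrite eqxx mulr1z mulr0z; ring.
  rewrite (_ : (Some i == Some j) = false) ?mul0r//.
  by apply/eqP => -[ij]; rewrite ij eqxx in ji.
rewrite big1 => [|j _]; last by rewrite (_ : (None == Some j) = false) ?mul0r.
by rewrite eqxx mulr1z /=; ring.
Qed.

Lemma generatorE b p : generator b p =
  1 / 2 * (1 + if b.1 then cos (2 * pi * coordinate b.2 p)
               else sin (2 * pi * coordinate b.2 p)).
Proof.
rewrite /generator /wave phase_coordinate; case: b.1; first by rewrite addr0.
by rewrite cosBpihalf.
Qed.

Lemma generator_trig b : trig (generator b).
Proof.
by apply: trig_scale; apply: trig_add; [exact: trig_cst|exact: trig_wave].
Qed.

Lemma generator_unit b p : 0 <= generator b p <= 1.
Proof.
rewrite /generator; set c := wave _ _ _ _ _.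
have : -1 <= c <= 1 by rewrite cos_geN1 cos_le1.
by move=> /andP[? ?]; apply/andP; split; lra.
Qed.

Lemma generator_continuous b : continuous (generator b).
Proof.
move=> p; apply: cvgM; first exact: cvg_cst.
by apply: cvgD; [exact: cvg_cst|exact: wave_continuous].
Qed.

Lemma generator_periodic b : st_periodic T (generator b).
Proof.
have [pT pe] := C12per_periodic (wave_C12per (b.2 == None)
  (fun j => (b.2 == Some j : nat)) (if b.1 then 0 else - (pi / 2)) T0).
split=> [p|i p]; rewrite /generator; congr (_ * (_ + _)).
  by have := pT p; rewrite -!surjective_pairing.
by have := pe i p; rewrite -!surjective_pairing.
Qed.

(** The difference [z = a - b] satisfies [cos (2 pi z) = 1], hence [sin (pi z) = 0]; this sine is
    positive for [z] strictly between [0] and [1], so only the two ends remain. *)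
Lemma cos_sin_2pi_inj (a b : R) : 0 <= a <= 1 -> 0 <= b <= 1 ->
  cos (2 * pi * a) = cos (2 * pi * b) -> sin (2 * pi * a) = sin (2 * pi * b) ->
  exists k : int, a = b + k%:~R.
Proof.
wlog ba : a b / b <= a.
  move=> H a01 b01 C S; have [/H|/ltW/H] := leP b a; first exact.
  by move=> /(_ b01 a01 (esym C) (esym S))[k ->]; exists (- k); rewrite intrN addrK.
move=> /andP[a0 a1] /andP[b0 b1] C S; pose z := a - b.
have cz : cos ((pi * z) *+ 2) = 1.
  rewrite (_ : _ *+ 2 = 2 * pi * a - 2 * pi * b); last by rewrite /z; ring.
  by rewrite cosB C S -!expr2 cos2Dsin2.
have sz : sin (pi * z) = 0.
  apply/eqP; rewrite -sqrf_eq0 sin2cos2; move: cz; rewrite cos_mulr2n mulr2n => cz.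
  by apply/eqP; lra.
have [z0|z0] := eqVneq z 0; first by exists 0; move: z0; rewrite /z => z0; lra.
have [z1|z1] := eqVneq z 1; first by exists 1; move: z1; rewrite /z => z1; lra.
have zgt0 : 0 < z by rewrite lt_neqAle eq_sym z0 /z subr_ge0.
have zlt1 : z < 1 by rewrite lt_neqAle z1 /z; lra.
have : 0 < sin (pi * z).
  by rewrite sin_gt0_pi// mulr_gt0 ?pi_gt0//= gtr_pMr// pi_gt0.
by rewrite sz ltxx.
Qed.

(** Points on opposite faces of the cell have the same generators, so the conclusion is about [f]
    and not [p = q]: the integer differences of the coordinates assemble into a lattice vector. *)
Lemma generator_separates f p q : st_periodic T f -> st_cube T p -> st_cube T q ->
  (forall b, generator b p = generator b q) -> f p = f q.
Proof.
move=> fper pK qK pq.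
have coord01 o r : st_cube T r -> 0 <= coordinate o r <= 1.
  case: o => [i|] [/= r1 r2] /=.
    by have := r2 i; rewrite /= in_itv.
  move: r1; rewrite in_itv/= ler_pdivrMr// mul1r => /andP[r0 ->].
  by rewrite divr_ge0// ltW.
have ex o : exists k : int, coordinate o p = coordinate o q + k%:~R.
  have c := pq (true, o); have s := pq (false, o); rewrite !generatorE/= in c s.
  by apply: cos_sin_2pi_inj; [exact: coord01|exact: coord01|lra|lra].
have [k kP] := choice ex.
have -> : p = q + st_lattice T (k None) (k \o Some); last exact: st_periodic_lattice.
rewrite st_latticeE; case: p q kP {pK qK pq ex} => [t x] [s y] kP.
congr (_, _) => /=; last by apply/rowP => i; rewrite !mxE; exact: (kP (Some i)).
have := kP None => /= E.
by rewrite -mulrzl -[LHS](divfK (lt0r_neq0 T0)) E mulrDl divfK ?lt0r_neq0.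
Qed.

(** A compactness argument on pairs in the cell. Around a pair with [f p = f q] the values of [f]
    stay within [e]; around any other pair some generator keeps a gap above [c / 2], so the premise
    fails once [eta < c / 2]. *)
Lemma generator_modulus f : continuous f -> st_periodic T f ->
  unif_cont_wrt (fun eta p q => forall b, `|generator b p - generator b q| <= eta) f.
Proof.
move=> cf fper e e0.
pose Q (eta : R) (r : (R * 'rV[R]_d) * (R * 'rV[R]_d)) :=
  (forall b, `|generator b r.1 - generator b r.2| <= eta) -> `|f r.1 - f r.2| <= e.
have cdiff g : continuous g -> continuous
    (fun r : (R * 'rV[R]_d) * (R * 'rV[R]_d) => `|g r.1 - g r.2|).
  move=> cg r; apply: cvg_norm; apply: cvgB.
    by apply: (@cvg_comp _ _ _ fst g); [exact: cvg_fst|exact: cg].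
  by apply: (@cvg_comp _ _ _ snd g); [exact: cvg_snd|exact: cg].
have KK := compact_setX (@st_cube_compact R d T) (@st_cube_compact R d T).
have cover : \forall eta \near 0^'+, st_cube T `*` st_cube T `<=` Q eta.
  apply: (compact_near_coveringP _).1 KK _ _ _ _ _ => -[p q] [/= pK qK].
  have [fpq|fpq] := eqVneq (f p) (f q).
    have : \forall r \near (p, q), `|f r.1 - f r.2| < e.
      by apply: (cvgr_lt _ (cdiff _ cf (p, q))); rewrite /= fpq subrr normr0.
    move=> near_e; exists ([set r | `|f r.1 - f r.2| < e], setT).
      by split => //; exact: filterT.
    by move=> [r eta] [/= /ltW re _] _.
  have [b bpq] : exists b, generator b p != generator b q.
    apply: contrapT => npq; move/eqP: fpq; apply; apply: (generator_separates fper) => // b.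
    by apply/eqP/negPn/negP => bpq; apply: npq; exists b.
  pose c := `|generator b p - generator b q|.
  have c0 : 0 < c / 2 by rewrite divr_gt0// normr_gt0 subr_eq0.
  have near_c : \forall r \near (p, q), c / 2 < `|generator b r.1 - generator b r.2|.
    apply: (cvgr_gt _ (cdiff _ (generator_continuous (b := b)) (p, q))) => /=.
    by rewrite -/c; lra.
  exists ([set r | c / 2 < `|generator b r.1 - generator b r.2|],
          [set eta | eta < c / 2]).
    by split => //=; exact: nbhs_right_lt.
  by move=> [r eta] [/= cr etac] /(_ b); rewrite leNgt (lt_trans etac cr).
have [eta [coverE eta0]] : exists eta : R, st_cube T `*` st_cube T `<=` Q eta /\ 0 < eta.
  near (0 : R)^'+ => eta; exists eta; split; last by near: eta; exact: nbhs_right_gt.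
  by near: eta; exact: cover.
exists eta => // p q pq.
have [p' p'K pE] := st_cube_rep T0 p; have [q' q'K qE] := st_cube_rep T0 q.
rewrite (pE _ fper) (qE _ fper); apply: (coverE (p', q')) => //= b.
by rewrite -(pE _ (generator_periodic b)) -(qE _ (generator_periodic b)).
Unshelve. all: by end_near. Qed.

Lemma In_map (I : eqType) (A : Type) (g : I -> A) (s : seq I) (a : A) :
  List.In a (map g s) <-> exists2 i, i \in s & a = g i.
Proof.
elim: s => [|j s IH] /=; first by split => // -[].
split => [[<-|/IH[i si ->]]|[i]].
- by exists j => //; rewrite mem_head.
- by exists i => //; rewrite inE si orbT.
- by rewrite inE => /predU1P[-> ->|si ai]; [left|right; apply/IH; exists i].
Qed.

Theorem trig_dense f : continuous f -> st_periodic T f ->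
  forall e : R, 0 < e -> exists2 P, trig P & forall p, `|f p - P p| <= e.
Proof.
move=> cf fper; have [M fM] := st_periodic_bounded T0 cf fper.
pose us := map generator (enum {: bool * option 'I_d}).
have usP u : List.In u us -> exists b, u = generator b.
  by move=> /In_map[b _ ->]; exists b.
apply: (@bernstein_approximation _ _ trig _ _ _ us f M (0, 0)) => //.
- exact: trig_cst.
- exact: trig_add.
- exact: trig_mul.
- by move=> u p /usP[b ->]; exact: generator_unit.
- by move=> u /usP[b ->]; exact: generator_trig.
- move=> e /(generator_modulus cf fper)[eta eta0 feta]; exists eta => // p q pq.
  apply: feta => b; apply: pq; apply/In_map; exists b => //.
  by rewrite mem_enum.
Qed.

(** Uniform continuity is inherited from an approximating trigonometric polynomial, at the cost of
    three errors [e / 3]. *)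
Lemma st_periodic_unif_cont f : continuous f -> st_periodic T f -> st_unif_cont f.
Proof.
move=> cf fper e e0; have e3 : 0 < e / 3 by rewrite divr_gt0.
have [P tP fP] := trig_dense cf fper e3.
have [delta d0 Pd] := trig_unif_cont tP e3; exists delta => // p q /Pd pq.
have := fP p; have := fP q; move: pq; rewrite !ler_norml => /andP[? ?] /andP[? ?] /andP[? ?].
by apply/andP; split; lra.
Qed.

End TrigonometricApproximation.

(** * Comparison of two functions through the Hamilton-Jacobi operator *)

Section Comparison.
Context {R : realType} {d : nat} (T : R) (H : 'rV[R]_d -> R) (m : R -> 'rV[R]_d -> R).
Hypothesis T0 : 0 < T.
Implicit Types phi v : R -> 'rV[R]_d -> R.

Definition hj_operator (eps : R) phi (t : R) (x : 'rV[R]_d) : R :=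
  dt phi t x - lapx (phi t) x + eps * H (gradx (phi t) x) + m t x.

(* At a maximum of [phi - v] the gradients agree, so the [H] terms cancel. *)
Lemma comparison_point eps phi v : C12per T phi -> C12per T v -> exists t x,
  hj_operator eps v t x <= hj_operator eps phi t x.
Proof.
move=> Cphi Cv; have [t [x [dt0 grad0 lap0]]] := C12per_max T0 (C12per_lin (-1) Cphi Cv).
exists t, x; move: dt0; rewrite (dt_lin _ _ _ Cphi Cv) mulN1r => /subr0_eq dt0.
move: grad0; rewrite (gradx_lin _ _ _ Cphi Cv) scaleN1r => /subr0_eq grad0.
move: lap0; rewrite (lapx_lin _ _ _ Cphi Cv) mulN1r subr_le0 => lap0.
by rewrite /hj_operator grad0 dt0 lerD2r lerD2r lerD2l lerN2.
Qed.

End Comparison.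

(** * Continuity and stability of [H] along gradients *)

Section GradientContinuity.
Context {R : realType} {d : nat} (T : R).
Implicit Types u v : R -> 'rV[R]_d -> R.

Lemma cvg_row (X : Type) (F : set_system X) (FF : Filter F) (f : 'I_d -> X -> R)
    (l : 'I_d -> R) :
  (forall i, f i @ F --> l i) -> (fun x => \row_i f i x) @ F --> \row_i l i.
Proof.
move=> fl A [P lP sPA].
have near_ij (ij : 'I_1 * 'I_d) : \forall x \near F, P ij.1 ij.2 (f ij.2 x).
  by apply: fl; have := lP ij.1 ij.2; rewrite mxE.
change (\forall x \near F, A (\row_i f i x)).
apply: filterS (filter_forall _ near_ij) => x Px; apply: sPA => i j.
by rewrite mxE; exact: (Px (i, j)).
Qed.

Lemma gradx_continuous u : C12per T u ->
  continuous (fun p : R * 'rV[R]_d => gradx (u p.1) p.2).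
Proof.
move=> [_ [_ [_ [_ [_ du]]]]] p; apply: cvg_row => i.
by have [_ [ci _]] := du i; exact: ci.
Qed.

Lemma gradx_periodic u : C12per T u ->
  (forall t x, gradx (u (t + T)) x = gradx (u t) x) /\
  (forall t i x, gradx (u t) (x + evec R i) = gradx (u t) x).
Proof.
move=> [uT [ux _]]; split => [t x|t i x].
  by congr gradx; apply/funext => y; rewrite uT.
apply/rowP => j; rewrite !mxE /pdx /derive.
rewrite (_ : (fun h : R => _) =
  (fun h : R => h^-1 *: ((u t \o shift x) (h *: evec R j) - u t x)))//.
by apply/funext => h /=; rewrite addrA !ux.
Qed.

Lemma H_gradx_periodic (H : 'rV[R]_d -> R) u : C12per T u ->
  st_periodic T (fun p => H (gradx (u p.1) p.2)).
Proof.
move=> Cu; have [gT gx] := gradx_periodic Cu.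
by split => [p|i p] /=; rewrite ?addr0 ?gT ?gx.
Qed.

Lemma H_gradx_continuous (H : 'rV[R]_d -> R) u : continuous H -> C12per T u ->
  continuous (fun p : R * 'rV[R]_d => H (gradx (u p.1) p.2)).
Proof.
move=> cH Cu p.
apply: (@cvg_comp _ _ _ (fun p : R * 'rV[R]_d => gradx (u p.1) p.2) H); last exact: cH.
exact: gradx_continuous.
Qed.

(** The difference is jointly continuous in the point and [eps] and vanishes at [eps = 0];
    [near_st_cube] then makes the smallness of [eps] independent of the point. *)
Lemma H_gradx_perturbation (H : 'rV[R]_d -> R) u v (delta : R) : 0 < T -> 0 < delta ->
  continuous H -> C12per T u -> C12per T v ->
  \forall eps \near 0^'+, forall t x,
    `|H (gradx (fun y => u t y + eps * v t y) x) - H (gradx (u t) x)| <= delta.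
Proof.
move=> T0 delta0 cH Cu Cv.
have cover : \forall eps \near 0^'+, forall p : R * 'rV[R]_d, st_cube T p ->
    `|H (gradx (fun y => u p.1 y + eps * v p.1 y) p.2) - H (gradx (u p.1) p.2)| <= delta.
  apply: near_st_cube => p.
  pose F := filter_prod (nbhs p) (0 : R)^'+.
  have F1 : fst @ F --> p by exact: cvg_fst.
  have F2 : snd @ F --> (0 : R).
    by apply: (@cvg_trans _ (0 : R)^'+); [exact: cvg_snd|exact: cvg_within].
  have pert : (fun r : (R * 'rV[R]_d) * R =>
      \row_i (pdx i (u r.1.1) r.1.2 + r.2 * pdx i (v r.1.1) r.1.2)) @ F -->
      \row_i (pdx i (u p.1) p.2 + 0 * pdx i (v p.1) p.2).
    apply: cvg_row => i.
    case: Cu => [_ [_ [_ [_ [_ /(_ i)[_ [cu _]]]]]]].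
    case: Cv => [_ [_ [_ [_ [_ /(_ i)[_ [cv _]]]]]]].
    apply: cvgD; last apply: cvgM => //.
      by apply: (@cvg_comp _ _ _ fst (fun p : R * 'rV[R]_d => pdx i (u p.1) p.2));
        [exact: F1|exact: cu].
    by apply: (@cvg_comp _ _ _ fst (fun p : R * 'rV[R]_d => pdx i (v p.1) p.2));
      [exact: F1|exact: cv].
  have base : (fun r : (R * 'rV[R]_d) * R => H (gradx (u r.1.1) r.1.2)) @ F -->
      H (gradx (u p.1) p.2).
    apply: (@cvg_comp _ _ _ fst (fun p : R * 'rV[R]_d => H (gradx (u p.1) p.2))).
      exact: F1.
    exact: (H_gradx_continuous cH Cu (x := p)).
  have pertH : (fun r : (R * 'rV[R]_d) * R =>
      H (gradx (fun y => u r.1.1 y + r.2 * v r.1.1 y) r.1.2)) @ F -->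
      H (gradx (u p.1) p.2).
    rewrite (_ : (fun r => _) = H \o (fun r : (R * 'rV[R]_d) * R =>
      \row_i (pdx i (u r.1.1) r.1.2 + r.2 * pdx i (v r.1.1) r.1.2))); last first.
      apply/funext => r /=; congr H; rewrite (gradx_lin _ _ _ Cu Cv).
      by apply/rowP => i; rewrite !mxE.
    apply: cvg_comp pert _; rewrite (_ : \row_i _ = gradx (u p.1) p.2); first exact: cH.
    by apply/rowP => i; rewrite !mxE mul0r addr0.
  have diff0 : (fun r : (R * 'rV[R]_d) * R =>
      `|H (gradx (fun y => u r.1.1 y + r.2 * v r.1.1 y) r.1.2) -
        H (gradx (u r.1.1) r.1.2)|) @ F --> (0 : R).
    rewrite -(normr0 R) -(subrr (H (gradx (u p.1) p.2))).
    by apply: cvg_norm; exact: cvgB.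
  by apply: (cvgr_le _ diff0).
near=> eps => t x.
have epsP : forall p : R * 'rV[R]_d, st_cube T p ->
    `|H (gradx (fun y => u p.1 y + eps * v p.1 y) p.2) - H (gradx (u p.1) p.2)| <= delta.
  by near: eps; exact: cover.
(* The perturbed and unperturbed terms are both periodic, so the same [q] represents [(t, x)] for
   each. *)
have [q qK qE] := st_cube_rep T0 (t, x).
have := epsP q qK; rewrite -(qE _ (H_gradx_periodic H Cu)).
by rewrite -(qE _ (H_gradx_periodic H (C12per_lin eps Cu Cv))).
Unshelve. all: by end_near. Qed.

End GradientContinuity.

(** * Two-sided bound on the eigenvalue and passage to the limit *)

Unset Implicit Arguments.
Set Strict Implicit.

Theorem theorem1p5 (R : realType) (d : nat) (T : R)
  (H : 'rV[R]_d -> R) (m : R -> 'rV[R]_d -> R)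
  (lam : R -> R) (psi0 : R -> 'rV[R]_d -> R) :
  (0 < d)%N -> 0 < T ->
  hypH H ->
  C12per T m ->
  (forall eps : R, 0 < eps -> is_eigenvalue T H m eps (lam eps)) ->
  C12per T psi0 ->
  (forall t x, dt psi0 t x - lapx (psi0 t) x = st_mean T m - m t x) ->
  st_int T psi0 = 0 ->
  (fun eps => (- lam eps - st_mean T m) / eps) x @[x --> 0^'+] -->
    st_mean T (fun t x => H (gradx (psi0 t) x)).
Proof.
move=> _ T0 [[cH _] _] _ eig Cpsi psi_eq _.
pose f (p : R * 'rV[R]_d) := H (gradx (psi0 p.1) p.2).
have cf : continuous f := H_gradx_continuous cH Cpsi.
have fper : st_periodic T f := H_gradx_periodic H Cpsi.
(* Three errors add up: the mean of [P] against that of [f], the values of [P] against those of [f],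
   and [H] at the gradient of [v] against [f]. *)
apply/cvgrPdist_le => e e0; pose delta := e / 3.
have delta0 : 0 < delta by rewrite divr_gt0.
have [P trigP fP] := trig_dense T0 cf fper delta0.
have [chi Cchi chi_eq] := trig_heat_solvable T0 trigP.
have mean_fP := st_mean_dist T0 (st_periodic_unif_cont T0 cf fper) (trig_unif_cont trigP) fP.
have near_close := H_gradx_perturbation T0 delta0 cH Cpsi Cchi.
(* [P] and [chi] depend on [e] alone and are fixed before [eps] is taken small. *)
near=> eps.
have eps0 : 0 < eps by near: eps; exact: nbhs_right_gt.
have close : forall t x,
    `|H (gradx (fun y => psi0 t y + eps * chi t y) x) - H (gradx (psi0 t) x)| <= delta.
  by near: eps; exact: near_close.
pose v t x := psi0 t x + eps * chi t x.
have Cv : C12per T v := C12per_lin eps Cpsi Cchi.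
pose M := st_mean T m; pose P0 := st_mean T (fun t x => P (t, x)).
(* The equation of [psi0] cancels [m] and leaves [M]; that of [chi] contributes [eps * (P0 - P)],
   leaving only the small residual [H (grad v) - P] at order [eps]. *)
have hj_v t x : hj_operator H m eps v t x =
    M + eps * (P0 + (H (gradx (v t) x) - P (t, x))).
  rewrite /hj_operator (dt_lin _ _ _ Cpsi Cchi) (lapx_lin _ _ _ Cpsi Cchi).
  rewrite -/(v t) opprD addrACA -mulrBr psi_eq chi_eq -/M -/P0.
  by move: (H _) (P _) (m t x) => h q mm; ring.
have hj_v_bound t x : M + eps * (P0 - (delta + delta)) <= hj_operator H m eps v t x <=
    M + eps * (P0 + (delta + delta)).
  have := close t x; have := fP (t, x); rewrite /f hj_v -/(v t) !lerD2l !ler_pM2l// !lerD2l.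
  move: (H _) (P _) (H _) => h q g; rewrite !ler_norml => /andP[? ?] /andP[? ?].
  by apply/andP; split; lra.
have [phi [Cphi phi_eq]] := eig eps eps0.
have hj_phi t x : hj_operator H m eps phi t x = - lam eps.
  have := phi_eq t x; rewrite /hj_operator.
  by move: (dt _ _ _) (lapx _ _) (H _) (m t x) => a b h mm E; lra.
have lower : M + eps * (P0 - (delta + delta)) <= - lam eps.
  have [t [x]] := comparison_point H m T0 eps Cphi Cv.
  by rewrite hj_phi; apply: le_trans; have /andP[] := hj_v_bound t x.
have upper : - lam eps <= M + eps * (P0 + (delta + delta)).
  have [t [x]] := comparison_point H m T0 eps Cv Cphi.
  by rewrite hj_phi => /le_trans; apply; have /andP[] := hj_v_bound t x.
rewrite -lerBrDl in lower; rewrite -lerBlDl in upper.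
have {}lower : P0 - (delta + delta) <= (- lam eps - M) / eps.
  by rewrite ler_pdivlMr// mulrC.
have {}upper : (- lam eps - M) / eps <= P0 + (delta + delta).
  by rewrite ler_pdivrMr// mulrC.
move: mean_fP lower upper; rewrite -/P0 -/M.
move: (_ / eps) (st_mean T (fun t x => f (t, x))) => c c0.
rewrite !ler_norml /delta => /andP[? ?] ? ?.
by apply/andP; split; lra.
Unshelve. all: by end_near. Qed.
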